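(* Let $x\geq 3$, $u\geq 1$, $\ell_1,\ldots,\ell_u\geq 3$ be integers, let $\mathcal G$ be a solution to $OP(x,{}^2\ell_1,\ldots,{}^2\ell_u)$, and let $\epsilon\in\{1,2\}$ with $\epsilon\equiv x\pmod 2$. Then $OP(y,\ell_1,\ldots,\ell_u)$ has a solution whenever (1) $y=2x+3\sum_{\beta=1}^u\ell_\beta-\epsilon$, or (2) $y=2x+3\sum_{\beta=1}^u\ell_\beta-\epsilon-2$, provided that $\mathcal G$ satisfies the matching property $(\mathcal M)$.
   Context: $K_v^*$ is $K_v$ for $v$ odd and $K_v$ minus a $1$-factor for $v$ even. A solution to $OP(F)$, $F$ a $2$-regular graph of order $v$, is a decomposition of $E(K_v^* )$ into spanning subgraphs isomorphic to $F$. $OP(m_1,\ldots,m_s)$ denotes $OP(F)$ with $F$ $2$-regular with cycle lengths $m_1,\ldots,m_s$; $OP(x,{}^2\ell_1,\ldots,{}^2\ell_u)$ has one $x$-cycle and two $\ell_i$-cycles for each $i$. A $(1,2)$-graph is a graph, not a matching, all of whose vertices have degree $1$ or $2$; $cs(\cdot)$ denotes the multiset of cycle lengths; $G\setminus H$ is $G$ with the edges of $H$ removed. A halving of $G\simeq[x,{}^2\ell_1,\ldots,{}^2\ell_u]$ is a subgraph $h(G)$ with $cs(h(G))=cs(G\setminus h(G))=\{\ell_1,\ldots,\ell_u\}$. A solution $\mathcal G$ satisfies the matching property $(\mathcal M)$ if there exist distinct $G,G'\in\mathcal G$, a halving $h(G')$ of $G'$, and a matching $M$ contained in $G$ such that $cs(G\setminus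 M)=\{\ell_1,\ldots,\ell_u\}=cs(h(G')\cup M)$ and $h(G')\cup M$ is a $(1,2)$-graph. *)

(* Defs.v *)
From mathcomp Require Import all_boot.
Set Implicit Arguments. Unset Strict Implicit. Unset Printing Implicit Defensive.

Section Graphs.
Variable v : nat.
Notation V := 'I_v.
Notation graph := {set {set V}}.

Definition simple_graph (G : graph) : bool := [forall e in G, #|e| == 2].

Definition Kv : graph := [set e : {set V} | #|e| == 2].

Definition deg (G : graph) (x : V) : nat := #|[set e in G | x \in e]|.

Definition adj (G : graph) : rel V := fun x y => (x != y) && ([set x; y] \in G).

Definition comp (G : graph) (x : V) : {set V} := [set y | connect (adj G) x y].

Definition cycle_comps (G : graph) : {set {set V}} :=
  [set C in [set comp G x | x : V] | [forall y in C, deg G y == 2]].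

(* cs(G): the multiset (as a sequence, compared up to perm_eq) of cycle lengths *)
Definition cs (G : graph) : seq nat := map (fun C : {set V} => #|C|) (enum (cycle_comps G)).

Definition two_regular (G : graph) : bool :=
  simple_graph G && [forall x, deg G x == 2].

Definition matching (M : graph) : bool :=
  simple_graph M && [forall x, deg M x <= 1].

Definition perfect_matching (M : graph) : bool :=
  simple_graph M && [forall x, deg M x == 1].

(* (1,2)-graph: every vertex of the graph (i.e. non-isolated vertex) has
   degree 1 or 2, and it is not a matching (some vertex has degree 2) *)
Definition one_two_graph (G : graph) : bool :=
  simple_graph G && [forall x, deg G x <= 2] && [exists x, deg G x == 2].

Definition is_Kstar (K : graph) : Prop :=
  if odd v then K = Kv
  else exists I : graph, perfect_matching I /\ K = Kv :\: I.

Definition OP_solution (ms : seq nat) (Gs : seq graph) : Prop :=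
  sumn ms = v /\
  (exists K : graph, is_Kstar K /\
     forall e : {set V}, count (fun G : graph => e \in G) Gs = (e \in K) :> nat) /\
  (forall G, G \in Gs -> two_regular G /\ perm_eq (cs G) ms).


(* halving of G (of type [x, ^2 l_1, ..., ^2 l_u]) w.r.t. ls = [l_1; ...; l_u] *)
Definition halving (ls : seq nat) (G h : graph) : bool :=
  (h \subset G) && perm_eq (cs h) ls && perm_eq (cs (G :\: h)) ls.

Definition matching_property (ls : seq nat) (Gs : seq graph) : Prop :=
  exists i j : nat, (i < size Gs) && (j < size Gs) && (i != j) /\
    exists h M : graph,
      [/\ halving ls (nth set0 Gs j) h, matching M /\ M \subset nth set0 Gs i,
          perm_eq (cs (nth set0 Gs i :\: M)) ls,
          perm_eq (cs (h :|: M)) ls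
        & one_two_graph (h :|: M)].

End Graphs.

Definition OP_solvable (ms : seq nat) : Prop :=
  exists Gs : seq {set {set 'I_(sumn ms)}}, OP_solution ms Gs.

(* Main.v *)
From mathcomp Require Import all_boot zify.
Require Import Defs.
Set Implicit Arguments. Unset Strict Implicit. Unset Printing Implicit Defensive.

(** Splitting every 2-factor of the given solution along its [x]-cycle yields a
    decomposition of the complete graph on [v] vertices (minus a 1-factor if [v]
    is even) into graphs of maximum degree two whose cycles have lengths exactly
    [ls]; under the matching property three of these graphs replace four, which
    saves one colour.  This decomposition is extended to the complete graph on
    [w] vertices by adding the missing vertices one at a time: each old vertex
    chooses the colour of its edge to the new vertex.  No colour may be chosen
    twice within one path, so no new cycle is closed before the last vertex,
    which closes all the paths of a colour into a single cycle.  Suitable choices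
    exist by Rado's theorem on independent transversals: with [n] vertices
    missing, giving every free half-edge weight [1/n] is a fractional solution. *)

(** * Paths and cycles in graphs of maximum degree two *)

(** Behind the one-vertex steps is an amalgamation: the [n] missing vertices act as a single vertex
    of [n] times the degree, and the edges among them become loops. With [k] cycle colours and a
    leave of degree [t], regularity forces the order [w = 2 * k + t + 1]. Halving [g] factors gives
    [k = 2 * g], hence [w = 2 * v - t - 1]; one colour fewer lowers [w] by two. This accounts for
    both values of [y], with [eps = t + 1]. The obstacle is room: a colour with more free half-edges
    than the missing vertices can absorb is never completed. So a room inequality is kept invariant,
    and each colour needs a lower bound on its number of choices besides the upper one. At the start
    a half leaves up to [2 * (v - sumn ls) - 2] half-edges free; in the second case, with [v] even
    and [sumn ls = 3], this fills the room exactly. Weight [1/n] serves only for [n > 1], when the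
    two ends of a path weigh at most one together. At [n = 1] nothing is left to choose: each cycle
    colour has one path left and both its ends are taken. *)

Lemma adj_sym v (G : {set {set 'I_v}}) : symmetric (adj G).
Proof. by move=> x y; rewrite /adj eq_sym setUC. Qed.

Lemma connect_adj_sym v (G : {set {set 'I_v}}) : connect_sym (adj G).
Proof. exact/sym_connect_sym/adj_sym. Qed.

Lemma adj_setU1 v (G : {set {set 'I_v}}) a b x y : a != b ->
  adj ([set a; b] |: G) x y =
  [|| adj G x y, (x == a) && (y == b) | (x == b) && (y == a)].
Proof.
move=> ab; rewrite /adj !inE andb_orr orbC; congr (_ || _).
apply/andP/orP => [[xy /eqP E]|].
  have: x \in [set a; b] by rewrite -E set21.
  have: y \in [set a; b] by rewrite -E set22.
  rewrite !in_set2 => /orP[]/eqP yE /orP[]/eqP xE; move: xy; rewrite xE yE ?eqxx //; auto.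
by case=> /andP[/eqP-> /eqP->]; rewrite ?(eq_sym b) ab // setUC.
Qed.

(** A walk in the larger graph may be assumed to cross the new edge at most once; the induction on
    the walk absorbs any further crossing. *)
Lemma connect_setU1 v (G : {set {set 'I_v}}) a b x y : a != b ->
  connect (adj ([set a; b] |: G)) x y =
  [|| connect (adj G) x y,
      connect (adj G) x a && connect (adj G) b y
    | connect (adj G) x b && connect (adj G) a y].
Proof.
move=> ab; set G' := _ |: G.
have sub : subrel (connect (adj G)) (connect (adj G')).
  by apply: connect_sub => p q pq; apply: connect1; rewrite adj_setU1 // pq.
have eab : connect (adj G') a b by apply: connect1; rewrite adj_setU1 // !eqxx orbT.
have eba : connect (adj G') b a by rewrite connect_adj_sym.
apply/idP/or3P => [/connectP[p]|].
- elim/last_ind: p y => [|p z IH] y /=; first by move=> _ ->; constructor; rewrite connect0.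
  rewrite rcons_path last_rcons => /andP[/IH/(_ erefl) {}IH + ->] {y}.
  rewrite adj_setU1 // => /or3P[/connect1 e|/andP[/eqP e /eqP->]|/andP[/eqP e /eqP->]].
  + case: IH => [h|/andP[h1 h2]|/andP[h1 h2]].
    * by constructor 1; apply: connect_trans e.
    * by constructor 2; rewrite h1 (connect_trans h2).
    * by constructor 3; rewrite h1 (connect_trans h2).
  + rewrite e in IH; case: IH => [h|/andP[h1 h2]|/andP[h1 h2]].
    * by constructor 2; rewrite h connect0.
    * by constructor 2; rewrite h1 connect0.
    * by constructor 1.
  + rewrite e in IH; case: IH => [h|/andP[h1 h2]|/andP[h1 h2]].
    * by constructor 3; rewrite h connect0.
    * by constructor 1.
    * by constructor 3; rewrite h1 connect0.
- case=> [/sub //|/andP[/sub h1 /sub h2]|/andP[/sub h1 /sub h2]].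
  + exact: connect_trans (connect_trans h1 eab) h2.
  + exact: connect_trans (connect_trans h1 eba) h2.
Qed.

Lemma comp_setU1 v (G : {set {set 'I_v}}) a b x : a != b ->
  comp ([set a; b] |: G) x =
  if (x \in comp G a) || (x \in comp G b) then comp G a :|: comp G b
  else comp G x.
Proof.
move=> ab; apply/setP=> y; case: ifPn; rewrite !inE connect_setU1 //.
- rewrite (connect_adj_sym G x a) (connect_adj_sym G x b).
  case/orP=> h; rewrite h /=.
  + rewrite -(same_connect (connect_adj_sym G) h) /=.
    by case: (connect _ a y); rewrite ?andbF ?orbF //= andbT.
  + rewrite -(same_connect (connect_adj_sym G) h) /=.
    by case: (connect _ b y); rewrite ?andbF ?orbF ?orbT //= andbT.
- rewrite negb_or (connect_adj_sym G x a) (connect_adj_sym G x b).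
  by case/andP=> /negbTE-> /negbTE->; rewrite orbF.
Qed.

Lemma comp_refl v (G : {set {set 'I_v}}) x : x \in comp G x.
Proof. by rewrite inE connect0. Qed.

Lemma comp_eq v (G : {set {set 'I_v}}) x y : y \in comp G x -> comp G y = comp G x.
Proof.
rewrite inE => xy; apply/setP=> z; rewrite !inE.
by rewrite (same_connect (connect_adj_sym G) xy).
Qed.

Lemma comp_disjoint v (G : {set {set 'I_v}}) x y :
  y \notin comp G x -> [disjoint comp G x & comp G y].
Proof.
move=> h; rewrite -setI_eq0; apply/eqP/setP=> z; rewrite in_set0 in_setI.
apply/negP=> /andP[/comp_eq zx /comp_eq zy].
by move/negP: h; apply; rewrite -zx zy comp_refl.
Qed.

(** * Degrees and free half-edges *)

Lemma deg_setU1 v (G : {set {set 'I_v}}) a b x : [set a; b] \notin G -> 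
  deg ([set a; b] |: G) x = (x \in [set a; b]) + deg G x.
Proof.
move=> h; rewrite /deg; case: (boolP (x \in _)) => /= hx.
  have -> : [set e in [set a; b] |: G | x \in e] =
            [set a; b] |: [set e in G | x \in e].
    apply/setP=> e; rewrite !inE.
    by case: eqP => [->|_] //=; move: hx; rewrite !inE => ->.
  by rewrite cardsU1 inE (negbTE h).
rewrite add0n; apply: eq_card => e; rewrite [LHS]inE [RHS]inE in_setU1.
by case: eqP => [->|_] //=; rewrite (negbTE hx) andbF.
Qed.

Lemma deg_setU1_le2 v (G : {set {set 'I_v}}) a b :
  (forall z, deg G z <= 2) -> deg G a < 2 -> deg G b < 2 -> [set a; b] \notin G ->
  forall z, deg ([set a; b] |: G) z <= 2.
Proof.
move=> d da db abG z; rewrite deg_setU1 // in_set2.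
by case: eqP => [->//|_]; case: eqP => [->//|_]; exact: d.
Qed.

Lemma deg0 v (x : 'I_v) : deg set0 x = 0.
Proof. by apply: eq_card0 => e; rewrite !inE. Qed.

Lemma deg_subset v (G H : {set {set 'I_v}}) x : G \subset H -> deg G x <= deg H x.
Proof.
move=> s; apply: subset_leq_card; apply/subsetP=> e.
by rewrite !inE => /andP[/(subsetP s)-> ->].
Qed.

Lemma deg_eq0 v (G : {set {set 'I_v}}) e x : deg G x = 0 -> e \in G -> x \notin e.
Proof.
move=> /eqP; rewrite cards_eq0 => /eqP h eG.
by move: (in_set0 e); rewrite -h inE eG => /negbT.
Qed.

(** Counts the free half-edges of a component in a graph that is to become two-regular: two for a
    path, an isolated vertex included, and none for a cycle. The subtraction truncates, so
    [cycle_compsP] has to bound the degrees separately. *)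
Definition stubs v (G : {set {set 'I_v}}) (x : 'I_v) : nat :=
  \sum_(z in comp G x) (2 - deg G z).

Lemma stubs_gt0 v (G : {set {set 'I_v}}) x z :
  z \in comp G x -> deg G z < 2 -> 0 < stubs G x.
Proof. by move=> zx dz; rewrite /stubs (bigD1 z) //=; lia. Qed.

Lemma simple_graphP v (G : {set {set 'I_v}}) :
  reflect (forall e, e \in G -> #|e| = 2) (simple_graph G).
Proof. by apply: (iffP forall_inP) => h e /h/eqP. Qed.

Lemma simple_graph_sub v (G H : {set {set 'I_v}}) :
  G \subset H -> simple_graph H -> simple_graph G.
Proof. by move=> /subsetP s /simple_graphP h; apply/simple_graphP=> e /s/h. Qed.

Lemma graph_ind v (P : {set {set 'I_v}} -> Prop) :
  P set0 ->
  (forall (G : {set {set 'I_v}}) a b, a != b -> simple_graph G -> [set a; b] \notin G ->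
     P G -> P ([set a; b] |: G)) ->
  forall G, simple_graph G -> P G.
Proof.
move=> P0 PS G; have [n] := ubnP #|G|; elim: n G => [//|n IH] G cG sG.
case: (set_0Vmem G) => [E|[e eG]]; first by rewrite E.
have /eqP/cards2P[a [b [ab E]]] : #|e| = 2 by move/simple_graphP: sG => ->.
rewrite -(setD1K eG) E; apply: PS => //; rewrite -?E ?setD11 //.
- exact: simple_graph_sub (subD1set _ _) sG.
- apply: IH; first by move: cG; rewrite (cardsD1 e) eG; lia.
  exact: simple_graph_sub (subD1set _ _) sG.
Qed.

(** The new edge uses one half-edge at each end; if the ends lie in different components, the two
    counts are pooled first. *)
Lemma stubs_setU1 v (G : {set {set 'I_v}}) a b x :
  a != b -> [set a; b] \notin G -> deg G a < 2 -> deg G b < 2 ->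
  stubs ([set a; b] |: G) x =
  if (x \in comp G a) || (x \in comp G b) then
    if b \in comp G a then stubs G a - 2 else stubs G a + stubs G b - 2
  else stubs G x.
Proof.
move=> ab abG da db; rewrite /stubs comp_setU1 //; case: ifPn => hx; last first.
  apply: eq_bigr => z zx; rewrite deg_setU1 //.
  suff -> : z \in [set a; b] = false by [].
  apply/negP; rewrite in_set2 => /orP[]/eqP E; move: zx; rewrite E => /comp_eq zx;
    by rewrite zx comp_refl ?orbT in hx.
have E1 (A : {set 'I_v}) : a \in A -> b \in A ->
    \sum_(z in A) (2 - deg ([set a; b] |: G) z) = \sum_(z in A) (2 - deg G z) - 2.
  move=> aA bA; rewrite (bigD1 a) //= (bigD1 b) /=; last by rewrite bA eq_sym.
  rewrite [in RHS](bigD1 a) //= [in RHS](bigD1 b) /=; last by rewrite bA eq_sym.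
  rewrite !deg_setU1 // !in_set2 !eqxx orbT /=.
  rewrite (eq_bigr (fun z => 2 - deg G z)); first by lia.
  by move=> z /andP[/andP[_ za] zb]; rewrite deg_setU1 // !in_set2 (negbTE za) (negbTE zb).
rewrite E1 ?in_setU ?comp_refl ?orbT //; case: ifPn => hb.
  by rewrite (comp_eq hb) setUid.
by rewrite -bigU ?comp_disjoint //; congr (_ - _); apply: eq_bigl => z; rewrite inE.
Qed.

(* A component of a graph of maximum degree two is a path or a cycle. *)
Lemma stubs_02 v (G : {set {set 'I_v}}) : simple_graph G ->
  (forall z, deg G z <= 2) -> forall x, stubs G x = 0 \/ stubs G x = 2.
Proof.
move: G; apply: graph_ind => [_ x|G a b ab sG abG IH d x].
  right; rewrite /stubs (eq_bigr (fun _ => 2)) => [|z _]; last by rewrite deg0.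
  rewrite (_ : comp set0 x = [set x]) ?big_set1 //.
  apply/setP=> y; rewrite !inE; apply/connectP/eqP => [[[|z p] /=]|->].
  - by [].
  - by rewrite /adj inE andbF.
  - by exists [::].
have {}d z : (z \in [set a; b]) + deg G z <= 2 by rewrite -deg_setU1.
have da : deg G a < 2 by move: (d a); rewrite set21.
have db : deg G b < 2 by move: (d b); rewrite set22.
have {}IH := IH (fun z => leq_trans (leq_addl _ _) (d z)).
rewrite stubs_setU1 //; case: ifP => // _.
(* Components with a free vertex have exactly two stubs, so joining two of them leaves [2 + 2 - 2]
   and closing one leaves [2 - 2]. *)
have := stubs_gt0 (comp_refl G a) da; have := stubs_gt0 (comp_refl G b) db.
by case: (IH a) => ->; case: (IH b) => ->; case: ifP; auto.
Qed.

Lemma cycle_compsP v (G : {set {set 'I_v}}) (C : {set 'I_v}) :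
  reflect (exists2 x, C = comp G x & stubs G x = 0 /\ forall z, z \in C -> deg G z <= 2)
          (C \in cycle_comps G).
Proof.
apply: (iffP setIdP) => [[/imsetP[x _ ->] /forall_inP h]|[x -> [s0 d]]].
  exists x => //; split; last by move=> z /h/eqP->.
  by apply: big1 => z /h/eqP->.
split; first exact: imset_f.
apply/forall_inP=> z zx; have /eqP := s0; rewrite sum_nat_eq0 => /forall_inP/(_ z zx).
by have := d z zx; lia.
Qed.

Lemma stubs_eq v (G : {set {set 'I_v}}) x y : y \in comp G x -> stubs G y = stubs G x.
Proof. by move=> /comp_eq; rewrite /stubs => ->. Qed.

Lemma simple_graph_setU1 v (G : {set {set 'I_v}}) a b :
  a != b -> simple_graph G -> simple_graph ([set a; b] |: G).
Proof.
move=> ab /simple_graphP sG; apply/simple_graphP=> e.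
by rewrite in_setU1 => /orP[/eqP->|/sG//]; rewrite cards2 ab.
Qed.

Lemma edge_in_comp v (G : {set {set 'I_v}}) a b :
  a != b -> [set a; b] \in G -> b \in comp G a.
Proof. by move=> ab abG; rewrite inE connect1 // /adj ab. Qed.

Lemma stubs_free v (G : {set {set 'I_v}}) a : simple_graph G ->
  (forall z, deg G z <= 2) -> deg G a < 2 -> stubs G a = 2.
Proof.
by move=> sG d /(stubs_gt0 (comp_refl G a)); case: (stubs_02 sG d a) => ->.
Qed.

(** Both components are paths, and linking two paths at free ends gives a path, which still has
    stubs and so is no cycle. *)
Lemma cycle_comps_join v (G : {set {set 'I_v}}) a b : simple_graph G ->
  (forall z, deg G z <= 2) -> deg G a < 2 -> deg G b < 2 -> b \notin comp G a ->
  cycle_comps ([set a; b] |: G) = cycle_comps G.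
Proof.
move=> sG d da db nab.
have ab : a != b by apply: contraNneq nab => ->; exact: comp_refl.
have abG : [set a; b] \notin G by apply: contra nab; exact: edge_in_comp.
have d' := deg_setU1_le2 d da db abG.
have sa := stubs_free sG d da; have sb := stubs_free sG d db.
apply/setP=> C; apply/cycle_compsP/cycle_compsP => -[x -> [s0 _]]; exists x.
- by move: s0; rewrite stubs_setU1 // comp_setU1 // (negbTE nab) sa sb; case: ifP.
- by move: s0; rewrite stubs_setU1 // (negbTE nab) sa sb; case: ifP.
- rewrite comp_setU1 //; case: ifP => // /orP[]/stubs_eq; lia.
- by split=> //; rewrite stubs_setU1 //; case: ifP => // /orP[]/stubs_eq; lia.
Qed.

(** Both free half-edges of the path are consumed, so its vertex set becomes a cycle component and
    no other component changes. *)
Lemma cycle_comps_close v (G : {set {set 'I_v}}) a b : simple_graph G ->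
  (forall z, deg G z <= 2) -> deg G a < 2 -> deg G b < 2 -> a != b ->
  [set a; b] \notin G -> b \in comp G a ->
  cycle_comps ([set a; b] |: G) = comp G a |: cycle_comps G.
Proof.
move=> sG d da db ab abG iab.
have d' := deg_setU1_le2 d da db abG.
have sa := stubs_free sG d da.
have cab := comp_eq iab.
apply/setP=> C; rewrite in_setU1; apply/cycle_compsP/orP => [[x -> [s0 _]]|].
- move: s0; rewrite stubs_setU1 // comp_setU1 // cab setUid; case: ifP => _ s0; first by left.
  by right; apply/cycle_compsP; exists x.
- case=> [/eqP->|/cycle_compsP[x -> [s0 _]]].
    exists a; first by rewrite comp_setU1 // comp_refl cab setUid.
    by split=> //; rewrite stubs_setU1 // comp_refl iab sa.
  have [] : x \notin comp G a by apply/negP=> /stubs_eq; lia.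
  move=> hx; exists x; first by rewrite comp_setU1 // cab orbb (negbTE hx).
  by split=> //; rewrite stubs_setU1 // cab orbb (negbTE hx).
Qed.

Lemma cs_close v (G : {set {set 'I_v}}) a b : simple_graph G ->
  (forall z, deg G z <= 2) -> deg G a < 2 -> deg G b < 2 -> a != b ->
  [set a; b] \notin G -> b \in comp G a ->
  perm_eq (cs ([set a; b] |: G)) (#|comp G a| :: cs G).
Proof.
move=> sG d da db ab abG iab; rewrite /cs cycle_comps_close // -map_cons.
apply/perm_map/uniq_perm; rewrite ?enum_uniq //=.
  rewrite enum_uniq andbT mem_enum; apply/negP=> /cycle_compsP[x E [s0 _]].
  have /stubs_eq : a \in comp G x by rewrite -E comp_refl.
  by rewrite stubs_free // s0.
by move=> C; rewrite mem_enum in_cons mem_enum in_setU1.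
Qed.

Lemma cs_join v (G : {set {set 'I_v}}) a b : simple_graph G ->
  (forall z, deg G z <= 2) -> deg G a < 2 -> deg G b < 2 -> b \notin comp G a ->
  cs ([set a; b] |: G) = cs G.
Proof. by move=> *; rewrite /cs cycle_comps_join. Qed.

(** * Incidence counts and the vertices covered by cycles *)

Lemma sum_card_incidence (T : finType) (G : {set {set T}}) :
  \sum_x #|[set e in G | x \in e]| = \sum_(e in G) #|e|.
Proof.
under eq_bigr => x _ do rewrite -sum1_card big_mkcond /=.
rewrite exchange_big /= [RHS]big_mkcond /=; apply: eq_bigr => e _.
case: ifP => eG.
  by rewrite -sum1_card [RHS]big_mkcond /=; apply: eq_bigr => x _; rewrite inE eG.
by apply: big1 => x _; rewrite inE eG.
Qed.

Lemma handshake v (G : {set {set 'I_v}}) : simple_graph G ->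
  \sum_x deg G x = 2 * #|G|.
Proof.
move=> /simple_graphP sG.
by rewrite sum_card_incidence (eq_bigr (fun _ => 2) sG) sum_nat_const mulnC.
Qed.

Lemma deg_adj v (G : {set {set 'I_v}}) x : simple_graph G ->
  deg G x = #|[set y | adj G x y]|.
Proof.
move=> /simple_graphP sG; rewrite /deg.
rewrite -(card_in_imset (f := fun y => [set x; y])).
  apply: eq_card => e; apply/setIdP/imsetP => [[eG xe]|[y]].
    have /eqP/cards2P[a [b [ab E]]] := sG _ eG.
    move: xe; rewrite E in_set2 => /orP[]/eqP->.
      by exists b; rewrite // inE /adj ab -E.
    by exists a; rewrite ?inE /adj 1?eq_sym ?ab /= setUC // -E.
  by rewrite inE => /andP[_ h] ->; rewrite h set21.
move=> y z; rewrite !inE => /andP[xy _] /andP[xz _] E.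
have: y \in [set x; z] by rewrite -E set22.
by rewrite in_set2 eq_sym (negbTE xy) /= => /eqP.
Qed.

Lemma cycle_comps_disjoint v (G : {set {set 'I_v}}) : trivIset (cycle_comps G).
Proof.
apply/trivIsetP=> A B /cycle_compsP[x -> _] /cycle_compsP[y -> _] AB.
by apply: comp_disjoint; apply: contra AB => /comp_eq->.
Qed.

Lemma sumn_cs v (G : {set {set 'I_v}}) : sumn (cs G) = #|cover (cycle_comps G)|.
Proof.
rewrite -(eqP (cycle_comps_disjoint G)) /cs -big_enum.
by elim: (enum _) => [|C s IH]; rewrite ?big_nil ?big_cons //= IH.
Qed.

Lemma deg_cycle v (G : {set {set 'I_v}}) x : x \in cover (cycle_comps G) -> deg G x = 2.
Proof. by case/bigcupP=> C; rewrite inE => /andP[_ /forall_inP h] /h/eqP. Qed.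

Lemma mem_cycle_comps v (G : {set {set 'I_v}}) x :
  (comp G x \in cycle_comps G) = (x \in cover (cycle_comps G)).
Proof.
apply/idP/bigcupP => [h|[C CG xC]]; first by exists (comp G x); rewrite ?comp_refl.
have /cycle_compsP[y E _] := CG.
by rewrite E in xC CG; rewrite (comp_eq xC).
Qed.

Lemma two_regular_cover v (G : {set {set 'I_v}}) :
  (forall x, deg G x = 2) -> cover (cycle_comps G) = [set: 'I_v].
Proof.
move=> h; apply/setP=> x; rewrite in_setT -mem_cycle_comps inE imset_f //=.
by apply/forall_inP=> y _; rewrite h.
Qed.

(** * Rado's theorem and balanced selections *)

(** The sets are shrunk to singletons, deleting elements as long as the Hall condition for [rho]
    survives. If neither of two elements of [A j0] can be deleted, both violating families contain
    [j0], and submodularity contradicts the condition for [J1 :|: J2] and [(J1 :&: J2) :\ j0]. *)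
Lemma rado (K E : finType) (rho : {set E} -> nat) (A : K -> {set E}) :
  rho set0 = 0 ->
  (forall X Y : {set E}, X \subset Y -> rho X <= rho Y) ->
  (forall X Y, rho (X :|: Y) + rho (X :&: Y) <= rho X + rho Y) ->
  (forall J : {set K}, #|J| <= rho (\bigcup_(j in J) A j)) ->
  exists2 f : K -> E, forall j, f j \in A j
    & forall J : {set K}, #|J| <= rho [set f j | j in J].
Proof.
move=> rho0 mono submod; have [n] := ubnP (\sum_j #|A j|).
elim: n A => [//|n IH] A bnd hall.
have ne j : 0 < #|A j|.
  have := hall [set j]; rewrite cards1 big_set1; rewrite card_gt0.
  by apply: contraL => /eqP->; rewrite rho0.
case: (boolP [exists j, 1 < #|A j|]) => [/existsP[j0 /card_gt1P[x [y [xA yA xy]]]]|].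
- pose B z j := if j == j0 then A j :\ z else A j.
  have sB z j : B z j \subset A j by rewrite /B; case: ifP => // _; exact: subD1set.
  have step z : z \in A j0 -> (forall J : {set K}, #|J| <= rho (\bigcup_(j in J) B z j)) ->
      exists2 f : K -> E, forall j, f j \in A j
      & forall J : {set K}, #|J| <= rho [set f j | j in J].
    move=> zA /IH[].
      move: bnd; rewrite (bigD1 j0) //= [X in _ -> X < _](bigD1 j0) //=.
      rewrite {1}/B eqxx (cardsD1 z (A j0)) zA.
      rewrite [X in _ -> _ + X < _](eq_bigr (fun j => #|A j|)); first by lia.
      by move=> j /negbTE jj; rewrite /B jj.
    by move=> f fB fJ; exists f => // j; apply: (subsetP (sB z j)).
  case: (boolP [forall J : {set K}, #|J| <= rho (\bigcup_(j in J) B x j)]) => [/forallP|].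
    exact: step.
  case: (boolP [forall J : {set K}, #|J| <= rho (\bigcup_(j in J) B y j)]) => [/forallP h _|].
    exact: (step y).
  rewrite !negb_forall => /existsP[J1 hJ1] /existsP[J2 hJ2]; exfalso.
  (* A violating family must contain [j0], since the other sets are unchanged. *)
  have inJ z (J : {set K}) : ~~ (#|J| <= rho (\bigcup_(j in J) B z j)) -> j0 \in J.
    apply: contraR => j0J; rewrite (eq_bigr A) // => j jJ.
    by rewrite /B; case: eqP => // E'; rewrite -E' jJ in j0J.
  have j01 := inJ _ _ hJ1; have j02 := inJ _ _ hJ2.
  set X1 := \bigcup_(j in J1) _ in hJ1; set X2 := \bigcup_(j in J2) _ in hJ2.
  (* Since [x != y], each deleted element survives in the other family, so together [X1] and [X2]
     cover all of [A j0]. *)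
  have hU : #|J1 :|: J2| <= rho (X1 :|: X2).
    apply: leq_trans (hall _) _; apply: mono; apply/subsetP=> e /bigcupP[j jJ ej].
    rewrite in_setU; case: (eqVneq j j0) => [jE|jj].
      case: (eqVneq e x) => [ex|ex]; apply/orP.
        by left; apply/bigcupP; exists j0 => //; rewrite /B eqxx in_setD1 -jE ej ex xy.
      by right; apply/bigcupP; exists j0 => //; rewrite /B eqxx in_setD1 -jE ej ex.
    move: jJ; rewrite in_setU => /orP[] jJ; apply/orP; [left|right];
      by apply/bigcupP; exists j => //; rewrite /B (negbTE jj).
  have hI : #|(J1 :&: J2) :\ j0| <= rho (X1 :&: X2).
    apply: leq_trans (hall _) _; apply: mono; apply/subsetP=> e /bigcupP[j].
    rewrite !inE => /and3P[jj jJ1 jJ2] ej.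
    by apply/andP; split; apply/bigcupP; exists j => //; rewrite /B (negbTE jj).
  (* The violations give [rho X1 + rho X2 <= #|J1| + #|J2| - 2], whereas [hU] and [hI] force at
     least [#|J1| + #|J2| - 1]. *)
  have := submod X1 X2; have := cardsUI J1 J2.
  have := cardsD1 j0 (J1 :&: J2); rewrite inE j01 j02.
  by move: hJ1 hJ2; rewrite -!ltnNge; lia.
- rewrite negb_exists => /forallP one.
  have hE j : exists e, A j == [set e].
    have /cards1P[e ->] : #|A j| == 1 by have := one j; have := ne j; lia.
    by exists e.
  exists (fun j => xchoose (hE j)) => [j|J].
    by rewrite {2}(eqP (xchooseP (hE j))) set11.
  apply: leq_trans (hall J) _; apply: mono; apply/bigcupsP=> j jJ.
  by rewrite (eqP (xchooseP (hE j))) sub1set imset_f.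
Qed.

(** The rank function of a partition matroid whose parts are the colour classes. *)
Definition cap_rank (I E : finType) (cap : I -> nat) (col : E -> I) (X : {set E}) :=
  \sum_i minn (cap i) #|[set e in X | col e == i]|.

Lemma cap_rank_mono (I E : finType) (cap : I -> nat) (col : E -> I) (X Y : {set E}) :
  X \subset Y -> cap_rank cap col X <= cap_rank cap col Y.
Proof.
move=> XY; apply: leq_sum => i _.
have : #|[set e in X | col e == i]| <= #|[set e in Y | col e == i]|.
  by apply/subset_leq_card/subsetP=> e; rewrite !inE => /andP[/(subsetP XY)-> ->].
by lia.
Qed.

(** Works colour by colour: [minn (cap i)] is concave, and union and intersection have the same
    total size as [X] and [Y] but sizes lying further apart. *)
Lemma cap_rank_submod (I E : finType) (cap : I -> nat) (col : E -> I) (X Y : {set E}) :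
  cap_rank cap col (X :|: Y) + cap_rank cap col (X :&: Y) <=
  cap_rank cap col X + cap_rank cap col Y.
Proof.
rewrite -!big_split; apply: leq_sum => i _ /=.
pose F (Z : {set E}) := [set e in Z | col e == i]; rewrite -!/(F _).
have := cardsUI (F X) (F Y).
have -> : F X :|: F Y = F (X :|: Y) by apply/setP=> e; rewrite !inE andb_orl.
have -> : F X :&: F Y = F (X :&: Y) by apply/setP=> e; rewrite !inE andbACA andbb.
have : #|F (X :&: Y)| <= #|F X|.
  by apply/subset_leq_card/subsetP=> e; rewrite !inE -andbA => /and3P[-> _ ->].
have : #|F (X :&: Y)| <= #|F Y|.
  by apply/subset_leq_card/subsetP=> e; rewrite !inE -andbA => /and3P[_ -> ->].
by lia.
Qed.

Lemma cap_rank_colour (I E : finType) (cap : I -> nat) (col : E -> I) (X : {set E}) i :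
  (forall e, e \in X -> col e = i) -> cap_rank cap col X <= minn (cap i) #|X|.
Proof.
move=> h; rewrite /cap_rank (bigD1 i) //= big1 ?addn0 => [|i' ii].
  have : #|[set e in X | col e == i]| <= #|X|.
    by apply/subset_leq_card/subsetP=> e; rewrite !inE => /andP[].
  by lia.
suff -> : [set e in X | col e == i'] = set0 by rewrite cards0 minn0.
apply/setP=> e; rewrite !inE; apply/negP=> /andP[/h-> ]; by rewrite eq_sym (negbTE ii).
Qed.

(** A single element has rank at most one, so the inequality for a two-element family excludes equal
    choices. For the family of all indices that choose colour [i], the rank is at most [cap i]. *)
Lemma rado_partition (I K E : finType) (cap : I -> nat) (col : E -> I) (A : K -> {set E}) :
  (forall J : {set K}, #|J| <= cap_rank cap col (\bigcup_(j in J) A j)) ->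
  exists f : K -> E, [/\ forall j, f j \in A j, injective f
    & forall i, #|[set j | col (f j) == i]| <= cap i].
Proof.
case/rado.
- apply: big1 => i _; suff -> : [set e in set0 | col e == i] = set0 by rewrite cards0 minn0.
  by apply/setP=> e; rewrite !inE.
- exact: cap_rank_mono.
- exact: cap_rank_submod.
move=> f fA fJ; exists f; split=> // [p q E1|i].
- apply/eqP; apply/negPn/negP => pq.
  have := fJ [set p; q]; rewrite cards2 pq imsetU1 imset_set1 E1 setUid.
  have : cap_rank cap col [set f q] <= minn (cap (col (f q))) #|[set f q]|.
    by apply: cap_rank_colour => e /set1P->.
  by rewrite cards1; lia.
- apply: leq_trans (fJ _) _.
  apply: leq_trans (cap_rank_colour (i := i) cap _) (geq_minl _ _).
  by move=> e /imsetP[j]; rewrite inE => /eqP E1 ->.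
Qed.

(* [s i z] is the number of free half-edges of colour [i] at [z], [r i z] its
   component, [l i] the number of loops of colour [i] at the amalgamated vertex.
   The partition matroid with capacities [cap] satisfies Rado's condition because
   giving every half-edge weight [1/n] is a fractional solution. *)
Lemma balanced_selection (I Z V : finType) (cap l : I -> nat)
    (s : I -> Z -> nat) (r : I -> Z -> V) (n : nat) :
  1 < n ->
  (forall z, \sum_i s i z = n) ->
  (forall i y, \sum_(z | r i z == y) s i z <= 2) ->
  (forall i, \sum_z s i z + 2 * l i = n * cap i) ->
  \sum_i 2 * l i = n * n.-1 ->
  exists c : Z -> I, [/\ forall z, 0 < s (c z) z,
    forall z z', z != z' -> c z = c z' -> r (c z) z != r (c z) z',
    forall i, #|[set z | c z == i]| <= cap i
    & forall i, cap i <= #|[set z | c z == i]| + l i].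
Proof.
move=> n1 hz hr hi hl.
pose N := \sum_i l i.
(* An element is a colour with one of its paths or one of its loops, so injectivity forbids taking a
   path twice. ['I_N] is a common index range, long enough for the loops of any colour. The choosers
   in [K] are the old vertices and the [n - 1] remaining missing vertices, whose edges to the new
   vertex come from loops. *)
pose E : finType := (I * (V + 'I_N))%type.
pose K : finType := (Z + 'I_n.-1)%type.
pose A (j : K) : {set E} := match j with
  | inl z => [set e : E | (0 < s e.1 z) && (e.2 == inl (r e.1 z))]
  | inr _ => [set e : E | if e.2 is inr q then q < l e.1 else false] end.
have hall (J : {set K}) : #|J| <= cap_rank cap (fun e : E => e.1) (\bigcup_(j in J) A j).
  pose J1 := [set z | inl z \in J]; pose J2 := [set q | inr q \in J].
  have cJ : #|J| = #|J1| + #|J2|.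
    rewrite -sum1_card big_mkcond /= big_sumType /= -!sum1_card.
    by congr (_ + _); rewrite [RHS]big_mkcond; apply: eq_bigr => z _; rewrite inE.
  (* The factor [b] switches the loops on exactly when [J] contains one of the missing vertices. *)
  pose b : nat := J2 != set0.
  have c2 : n * #|J2| <= b * \sum_i 2 * l i.
    rewrite hl /b; case: eqP => [->|_]; rewrite ?cards0 ?muln0 // mul1n leq_mul2l.
    by rewrite -[X in _ <= X]card_ord max_card orbT.
  have c1 : n * #|J1| = \sum_i \sum_(z in J1) s i z.
    rewrite exchange_big (eq_bigr (fun _ => n)) // sum_nat_const; lia.
  (* Multiplying by [n] clears the weights [1/n]; what remains is compared one colour at a time. *)
  rewrite -(leq_pmul2l (ltnW n1)) cJ mulnDr c1.
  apply: leq_trans (leq_add (leqnn _) c2) _.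
  rewrite big_distrr big_distrr -big_split /=; apply: leq_sum => i _.
  set X := [set e in _ | _].
  have h1 : \sum_(z in J1) s i z <= \sum_z s i z.
    by rewrite [X in X <= _]big_mkcond; apply: leq_sum => z _; case: ifP.
  pose P := [set z in J1 | 0 < s i z].
  have h2 : \sum_(z in J1) s i z <= 2 * #|r i @: P|.
    rewrite (bigID (mem P)) /= [X in _ + X]big1 ?addn0; last first.
      by move=> z /andP[zJ]; rewrite inE zJ /=; lia.
    rewrite (eq_bigl (mem P)); last by move=> z; apply: andb_idl => /setIdP[].
    rewrite (partition_big_imset (r i)) mulnC -sum_nat_const; apply: leq_sum => y _.
    apply: leq_trans (hr i y); rewrite big_mkcondl; apply: leq_sum => z _.
    by case: ifP.
  have h3 : #|r i @: P| + b * l i <= #|X|.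
    pose X1 := [set ((i, inl y) : E) | y in r i @: P].
    pose X2 := [set ((i, inr q) : E) | q : 'I_N & (0 < b) && (q < l i)].
    have <- : #|X1| = #|r i @: P| by rewrite /X1 card_imset // => p q [].
    have <- : #|X2| = b * l i.
      rewrite /X2 card_imset; last by move=> p q [].
      rewrite /b; case: eqP => /= _; first by rewrite mul0n; apply: eq_card0 => q; rewrite inE.
      rewrite mul1n; have li : l i <= N by rewrite /N (bigD1 i) //= leq_addr.
      rewrite -[RHS]card_ord -[RHS](card_imset _ (f := widen_ord li)); last first.
        by move=> p q /(congr1 val)/= /val_inj.
      apply: eq_card => q; rewrite inE; apply/idP/imsetP => [ql|[p _ ->]]; last exact: (ltn_ord p).
      by exists (Ordinal ql) => //; apply: val_inj.
    have <- : #|X1 :|: X2| = #|X1| + #|X2|.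
      apply/eqP; rewrite -[_ == _]/(_ == _) cardsU (_ : X1 :&: X2 = set0) ?cards0 ?subn0 //.
      by apply/setP=> e; rewrite !inE; apply/negP=> /andP[/imsetP[y _ ->] /imsetP[q _]].
    apply/subset_leq_card/subsetP=> e; rewrite in_setU => /orP[] /imsetP[].
      move=> _ /imsetP[z + ->] ->; rewrite !inE eqxx andbT => /andP[zJ sz].
      by apply/bigcupP; exists (inl z) => //; rewrite inE /= sz eqxx.
    move=> q; rewrite inE => /andP[b0 ql] ->; rewrite inE eqxx andbT.
    have /set0Pn[q' q'J] : J2 != set0 by move: b0; rewrite lt0b.
    by rewrite inE in q'J; apply/bigcupP; exists (inr q'); rewrite // inE.
  have h4 : b * (2 * l i) <= 2 * l i by rewrite -[X in _ <= X]mul1n leq_mul2r leq_b1 orbT.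
  (* Here [n > 1] enters: a path or loop carries at most two half-edges, hence weight at most
     [2/n <= 1]. *)
  have h5 : 2 * #|X| <= n * #|X| by rewrite leq_mul2r n1 orbT.
  move: (hi i) h1 h2 h3 h4 h5; rewrite mulnCA.
  move: (\sum_z s i z) (\sum_(z in J1) s i z) #|r i @: P| (b * l i) #|X| => S a p bl q.
  by move=> ? ? ? ? ? ?; rewrite /minn; case: ifP => _; lia.
have [f [fA finj cardi]] := rado_partition hall.
(* There are exactly as many choosers as total capacity, so every colour is filled. Whatever the old
   vertices leave of [cap i] is taken by loops, of which there are [l i]; this is the lower bound in
   the conclusion. *)
have szi : \sum_i cap i = #|Z| + n.-1.
  have : \sum_i (\sum_z s i z + 2 * l i) = \sum_i n * cap i by apply: eq_bigr.
  rewrite big_split /= hl exchange_big /= (eq_bigr (fun _ => n)) // sum_nat_const -big_distrr /=.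
  by move/eqP; rewrite mulnC -mulnDr eqn_pmul2l ?(ltnW n1) // => /eqP<-.
have carde i : #|[set j | (f j).1 == i]| = cap i.
  apply/eqP; rewrite eqn_leq cardi /=.
  have : \sum_i #|[set j | (f j).1 == i]| = \sum_i cap i.
    rewrite szi -[in RHS](card_ord n.-1) -card_sum -sum1_card.
    rewrite (partition_big (fun j => (f j).1) predT) //=; apply: eq_bigr => i' _.
    by rewrite -sum1_card; apply: eq_bigl => j; rewrite inE.
  rewrite (bigD1 i) //= [X in _ = X -> _](bigD1 i) //=.
  set S := \sum_(j | j != i) #|_|; have : S <= \sum_(j | j != i) cap j by exact: leq_sum.
  move: S (\sum_(_ | _) _) (#|_|) => S T q; lia.
have fin z : 0 < s (f (inl z)).1 z /\ (f (inl z)).2 = inl (r (f (inl z)).1 z).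
  by have := fA (inl z); rewrite inE => /andP[-> /eqP].
have split_card i : #|[set j | (f j).1 == i]| =
    #|[set z | (f (inl z)).1 == i]| + #|[set q | (f (inr q)).1 == i]|.
  rewrite -!sum1_card ![\sum_(_ in _) 1]big_mkcond /= big_sumType /=.
  by congr (_ + _); apply: eq_bigr => z _; rewrite !inE.
exists (fun z => (f (inl z)).1); split=> [z|z z' zz E1|i|i].
- by case: (fin z).
- apply: contra zz => /eqP E2; have [_ e1] := fin z; have [_ e2] := fin z'.
  suff /finj[->] : f (inl z) = f (inl z') by [].
  by rewrite [LHS]surjective_pairing [RHS]surjective_pairing e1 e2 -E1 E2.
- by rewrite -carde split_card leq_addr.
- rewrite -carde split_card leq_add2l.
  have li : l i <= N by rewrite /N (bigD1 i) //= leq_addr.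
  rewrite -[X in _ <= X]card_ord -(card_imset _ (f := fun q : 'I_n.-1 => f (inr q))); last first.
    by move=> p q /finj[].
  rewrite -(card_imset _ (f := fun q : 'I_(l i) => ((i, inr (widen_ord li q)) : E))); last first.
    by move=> p q [] /val_inj.
  apply/subset_leq_card/subsetP=> e /imsetP[q]; rewrite inE => /eqP E1 ->.
  have := fA (inr q); rewrite inE; case E2 : (f (inr q)) => [i' [//|q']] /= ql.
  rewrite E2 /= in E1; rewrite E1 in ql *; apply/imsetP; exists (Ordinal ql) => //.
  by congr (_, inr _); apply: val_inj.
Qed.

(** * Adding a vertex *)

Lemma comp_isolated v (G : {set {set 'I_v}}) a : deg G a = 0 -> comp G a = [set a].
Proof.
move=> da; apply/setP=> y; rewrite !inE; apply/connectP/eqP => [[[|z p] /=]|->].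
- by [].
- by move=> /andP[/andP[_ /(deg_eq0 da)]]; rewrite set21.
- by exists [::].
Qed.

Lemma deg_setU v (G H : {set {set 'I_v}}) x : [disjoint G & H] ->
  deg (G :|: H) x = deg G x + deg H x.
Proof.
move=> dGH; rewrite /deg -cardsUI.
have -> : [set e in G | x \in e] :&: [set e in H | x \in e] = set0.
  apply/setP=> e; rewrite !inE; apply/negP=> /andP[/andP[eG _] /andP[eH _]].
  by move: dGH; rewrite -setI_eq0 => /eqP/setP/(_ e); rewrite !inE eG eH.
by rewrite cards0 addn0; apply: eq_card => e; rewrite !inE andb_orl.
Qed.

Lemma sum_deg_partition (I : finType) v (G : I -> {set {set 'I_v}}) (K : {set {set 'I_v}}) z :
  (forall e, \sum_i (e \in G i) = (e \in K)) -> \sum_i deg (G i) z = deg K z.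
Proof.
move=> h; have E (H : {set {set 'I_v}}) : deg H z = \sum_(e : {set 'I_v} | z \in e) (e \in H).
  rewrite /deg -sum1_card big_mkcond [RHS]big_mkcond /=; apply: eq_bigr => e _.
  by rewrite inE; do 2!case: (_ \in _).
under eq_bigr do rewrite E.
by rewrite exchange_big E /=; apply: eq_bigr.
Qed.

(** * Joining a new vertex to old ones *)

Definition star v (a : 'I_v) (S : {set 'I_v}) : {set {set 'I_v}} :=
  [set [set z; a] | z in S].

Lemma star_inj v (a : 'I_v) (S : {set 'I_v}) : a \notin S ->
  {in S &, injective (fun z => [set z; a])}.
Proof.
move=> aS y z yS zS /= E; have: y \in [set z; a] by rewrite -E set21.
by rewrite in_set2 => /orP[/eqP//|/eqP ya]; rewrite -ya yS in aS.
Qed.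

Lemma deg_star v (a : 'I_v) (S : {set 'I_v}) y : a \notin S ->
  deg (star a S) y = if y == a then #|S| else y \in S.
Proof.
move=> aS; rewrite /deg.
have -> : [set e in star a S | y \in e] =
    [set [set z; a] | z in [set z in S | y \in [set z; a]]].
  apply/setP=> e; apply/setIdP/imsetP => [[/imsetP[z zS ->] ye]|[z]].
    by exists z; rewrite // inE zS.
  by rewrite inE => /andP[zS yz] ->; split=> //; apply: imset_f.
rewrite card_in_imset; last first.
  by move=> p q /setIdP[pS _] /setIdP[qS _]; apply: (star_inj aS).
case: eqP => [->|/eqP ya]; first by apply: eq_card => z; rewrite inE set22 andbT.
case: (boolP (y \in S)) => yS.
  rewrite -[RHS](cards1 y); apply: eq_card => z; rewrite !inE (negbTE ya) orbF eq_sym.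
  by apply: andb_idl => /eqP->.
apply: eq_card0 => z; rewrite !inE (negbTE ya) orbF.
by apply/negP=> /andP[zS /eqP yz]; rewrite yz zS in yS.
Qed.

Lemma star0 v (a : 'I_v) : star a set0 = set0.
Proof. exact: imset0. Qed.

Lemma starU1 v (a b : 'I_v) (S : {set 'I_v}) : star a (b |: S) = [set b; a] |: star a S.
Proof. by rewrite /star imsetU1. Qed.

Lemma disjoint_star v (G : {set {set 'I_v}}) a S : deg G a = 0 -> [disjoint G & star a S].
Proof.
move=> da; rewrite -setI_eq0; apply/eqP/setP=> e; rewrite in_set0 in_setI.
by apply/negP=> /andP[/(deg_eq0 da) ae /imsetP[z _ E]]; rewrite E set22 in ae.
Qed.

(** Edges from [a] to at most two different paths extend a path or merge two of them through [a], so
    no cycle is closed. *)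
Lemma cs_star_join v (G : {set {set 'I_v}}) a (S : {set 'I_v}) : simple_graph G ->
  (forall z, deg G z <= 2) -> deg G a = 0 -> a \notin S -> #|S| <= 2 ->
  {in S, forall z, deg G z < 2} ->
  {in S &, forall y z, y != z -> z \notin comp G y} ->
  cs (star a S :|: G) = cs G.
Proof.
move=> sG d da aS; rewrite leq_eqVlt ltnS leq_eqVlt ltnS leqn0 cards_eq0.
case/or3P=> [/cards2P[y [z [yz SE]]]|/cards1P[y SE]|/eqP->]; last first.
- by rewrite star0 set0U.
- rewrite SE in aS *; move=> dS _; rewrite -[[set y]]setU0 starU1 star0 setU0.
  have dy := dS y (set11 y); rewrite cs_join ?da //; apply: contra aS => /comp_eq.
  by rewrite comp_isolated // => E; rewrite in_set1 eq_sym -in_set1 E comp_refl.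
rewrite SE in aS * => dS cS; rewrite starU1 -[[set z]]setU0 starU1 star0 setU0 -setUA.
have [ay az] : a != y /\ a != z by move: aS; rewrite in_set2 negb_or => /andP[].
have na u : u != a -> a \notin comp G u.
  move=> ua; apply/negP=> /comp_eq; rewrite comp_isolated // => E.
  by move: (comp_refl G u); rewrite -E inE (negbTE ua).
have dy := dS y (set21 _ _); have dz := dS z (set22 _ _).
have zaG : [set z; a] \notin G by apply/negP=> /(deg_eq0 da); rewrite set22.
have z_a : z != a by rewrite eq_sym.
have dza : z \in comp ([set z; a] |: G) a.
  by rewrite comp_setU1 // comp_refl orbT in_setU comp_refl.
have nya : a \notin comp ([set z; a] |: G) y.
  rewrite comp_setU1 //.
  have -> : y \in comp G z = false by apply/negbTE/cS; rewrite ?set21 ?set22 // eq_sym.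
  rewrite comp_isolated // inE eq_sym (negbTE ay) /=; apply: na; by rewrite eq_sym.
rewrite cs_join //.
- by rewrite cs_join // ?da // na.
- exact: simple_graph_setU1.
- by apply: deg_setU1_le2; rewrite ?da ?dz.
- by rewrite deg_setU1 // in_set2 (negbTE yz) eq_sym (negbTE ay).
- by rewrite deg_setU1 // set22 da.
Qed.

(** The two ends of one path are joined through [a]. The length of the resulting cycle stays open
    here and is found later by counting vertices. *)
Lemma cs_star_close v (G : {set {set 'I_v}}) a (S : {set 'I_v}) : simple_graph G ->
  (forall z, deg G z <= 2) -> deg G a = 0 -> a \notin S -> #|S| = 2 ->
  {in S, forall z, deg G z = 1} -> {in S &, forall y z, z \in comp G y} ->
  exists q, perm_eq (cs (star a S :|: G)) (q :: cs G).
Proof.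
move=> sG d da aS /eqP/cards2P[y [z [yz SE]]] dS cS.
rewrite SE in aS dS cS *; rewrite starU1 -[[set z]]setU0 starU1 star0 setU0 -setUA.
have [ay az] : a != y /\ a != z by move: aS; rewrite in_set2 negb_or => /andP[].
have dy := dS y (set21 _ _); have dz := dS z (set22 _ _).
have zaG : [set z; a] \notin G by apply/negP=> /(deg_eq0 da); rewrite set22.
have z_a : z != a by rewrite eq_sym.
have yza : y \in comp G z by apply: cS; rewrite ?set21 ?set22.
have naz : a \notin comp G z.
  apply/negP=> /comp_eq; rewrite comp_isolated // => E.
  by move: (comp_refl G z); rewrite -E inE (negbTE z_a).
exists #|comp ([set z; a] |: G) y|.
have := @cs_close _ ([set z; a] |: G) y a; rewrite (@cs_join _ G z a) ?dz ?da //; apply.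
- exact: simple_graph_setU1.
- by apply: deg_setU1_le2; rewrite ?da ?dz.
- by rewrite deg_setU1 // in_set2 (negbTE yz) eq_sym (negbTE ay) dy.
- by rewrite deg_setU1 // set22 da.
- by rewrite eq_sym.
- rewrite in_setU1 negb_or; apply/andP; split.
    apply/eqP=> /setP/(_ y); rewrite set21 in_set2 (negbTE yz) eq_sym (negbTE ay).
    by [].
  by apply/negP=> /(deg_eq0 da); rewrite set22.
- by rewrite comp_setU1 // yza in_setU comp_refl orbT.
Qed.

(** * Complete graphs on an initial segment, and outlines *)

Definition below w (m : nat) : {set 'I_w} := [set z : 'I_w | z < m].

Definition active_graph w (m : nat) : {set {set 'I_w}} :=
  [set e : {set 'I_w} | (#|e| == 2) && (e \subset below w m)].

Lemma card_below w m : m <= w -> #|below w m| = m.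
Proof.
move=> mw; rewrite -sum1_card (eq_bigl (fun z : 'I_w => z < m)); last by move=> z; rewrite inE.
by rewrite (big_ord_narrow mw) sum1_card card_ord.
Qed.

Lemma active_graph_simple w m : simple_graph (active_graph w m).
Proof. by apply/simple_graphP=> e; rewrite inE => /andP[/eqP]. Qed.

Lemma deg_active w m (z : 'I_w) : m <= w -> z < m -> deg (active_graph w m) z = m.-1.
Proof.
move=> mw zm; rewrite deg_adj ?active_graph_simple //.
have := cardsD1 z (below w m); rewrite card_below // inE zm add1n => E.
rewrite (congr1 predn E) /=; apply: eq_card => y.
rewrite [LHS]inE [RHS]in_setD1 /adj [_ \in active_graph _ _]inE cards2.
by rewrite (eq_sym y); case: eqP => //= _; rewrite subUset !sub1set !inE zm.
Qed.

Lemma active_graph_isolated w m (H : {set {set 'I_w}}) (a : 'I_w) :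
  H \subset active_graph w m -> m <= a -> deg H a = 0.
Proof.
move=> /subsetP sH ma; apply: eq_card0 => e; rewrite inE; apply/negP=> /andP[/sH].
by rewrite inE => /andP[_ /subsetP h] /h; rewrite inE ltnNge ma.
Qed.

Lemma partition_sub (I : finType) v (G : I -> {set {set 'I_v}}) (K : {set {set 'I_v}}) i :
  (forall e, \sum_i (e \in G i) = (e \in K)) -> G i \subset K.
Proof.
move=> h; apply/subsetP=> e eG; have := h e; rewrite (bigD1 i) //= eG.
by case: (e \in K).
Qed.

Lemma partition_star (I : finType) w m (a : 'I_w) (G : I -> {set {set 'I_w}}) (c : 'I_w -> I) :
  a = m :> nat ->
  (forall e, \sum_i (e \in G i) = (e \in active_graph w m)) ->
  forall e, \sum_i (e \in star a [set y in below w m | c y == i] :|: G i) =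
            (e \in active_graph w m.+1).
Proof.
move=> am h e.
have aG i : deg (G i) a = 0 by apply: active_graph_isolated (partition_sub i h) _; rewrite am.
have [ae|ae] := boolP (a \in e); last first.
  rewrite (eq_bigr (fun i => (e \in G i) : nat)) => [|i _]; last first.
    rewrite in_setU; case: imsetP => // -[y _ E]; by rewrite E set22 in ae.
  rewrite h !inE; congr (nat_of_bool (_ && _)).
  apply/subsetP/subsetP => he z ze; have := he z ze; rewrite !inE; first by lia.
  rewrite ltnS leq_eqVlt => /orP[/eqP E|//].
  by rewrite -am in E; rewrite -(val_inj E) ze in ae.
have [/andP[e2 es]|] := boolP ((#|e| == 2) && (e \subset below w m.+1)); last first.
  move=> he; rewrite inE (negbTE he); apply: big1 => i _.
  rewrite in_setU; have -> : e \in G i = false.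
    by apply/negP=> eG; have := deg_eq0 (aG i) eG; rewrite ae.
  case: imsetP => // -[y]; rewrite !inE => /andP[ym _] E; case/negP: he.
  rewrite E cards2; have -> : y != a by rewrite -val_eqE /= am; lia.
  by rewrite subUset !sub1set !inE; lia.
rewrite inE e2 es /=.
have [y ym E] : exists2 y : 'I_w, y < m & e = [set y; a].
  have /cards2P[p [q [pq E]]] := e2.
  move: ae es; rewrite E in_set2 subUset !sub1set !inE => /orP[]/eqP aE /andP[hp hq].
  - exists q; last by rewrite aE setUC.
    by move: pq; rewrite -aE -val_eqE /= am; lia.
  - exists p; last by rewrite aE.
    by move: pq; rewrite -aE -val_eqE /= am; lia.
rewrite (bigD1 (c y)) //= big1 => [|i ic]; rewrite in_setU E.
  suff -> : [set y; a] \in star a [set y0 in below w m | c y0 == c y] by [].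
  by apply: imset_f; rewrite !inE ym eqxx.
have -> : [set y; a] \in G i = false.
  by apply/negP=> /(deg_eq0 (aG i)); rewrite set22.
rewrite orbF; case: imsetP => // -[z]; rewrite !inE => /andP[zm /eqP cz] E'.
have : y \in [set z; a] by rewrite -E' set21.
rewrite in_set2 => /orP[]/eqP yE; last by move: ym; rewrite yE am ltnn.
by rewrite yE cz eqxx in ic.
Qed.

(** The degree each colour must finally reach at every vertex. [None] is the leave: a 1-factor for
    [t = 1], empty for [t = 0]. *)
Definition cap k t (i : option 'I_k) : nat := if i is Some _ then 2 else t.

Lemma sum_option k (F : option 'I_k -> nat) : \sum_i F i = F None + \sum_i F (Some i).
Proof.
rewrite (bigD1 None) //= (reindex_omap Some id) /=; last by case.
by congr (_ + _); apply: eq_bigl => i; rewrite eqxx.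
Qed.

Lemma sum_cap k t : \sum_i @cap k t i = 2 * k + t.
Proof. by rewrite sum_option /= sum_nat_const card_ord addnC mulnC. Qed.

(* A decomposition of the complete graph on the first [m] vertices into [k]
   graphs with cycles [ls] and a graph of maximum degree [t] (colour [None]),
   each of which has room to be completed with [w - m] more vertices. *)
Definition outline w k t ls m (G : option 'I_k -> {set {set 'I_w}}) : Prop :=
  [/\ forall e, \sum_i (e \in G i) = (e \in active_graph w m),
      forall i z, deg (G i) z <= cap t i,
      forall i, \sum_(z in below w m) (cap t i - deg (G i) z) <= cap t i * (w - m)
    & forall i, perm_eq (cs (G (Some i))) ls].

(** The capacities add up to [w - 1] and the active edges at [z] use [m - 1] of it, which leaves one
    half-edge for each missing vertex. *)
Lemma outline_free w k t ls m (G : option 'I_k -> {set {set 'I_w}}) (z : 'I_w) :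
  w = 2 * k + t + 1 -> m <= w -> outline t ls m G -> z < m ->
  \sum_i (cap t i - deg (G i) z) = w - m.
Proof.
move=> wE mw [hp hd _ _] zm.
have : \sum_i (cap t i - deg (G i) z) + \sum_i deg (G i) z = \sum_i @cap k t i.
  by rewrite -big_split; apply: eq_bigr => i _; rewrite /= subnK.
rewrite (sum_deg_partition z hp) deg_active // sum_cap; lia.
Qed.

Lemma outline_simple w k t ls m (G : option 'I_k -> {set {set 'I_w}}) i :
  outline t ls m G -> simple_graph (G i).
Proof.
by case=> hp _ _ _; apply: simple_graph_sub (partition_sub i hp) (active_graph_simple w m).
Qed.

Lemma outline_isolated w k t ls m (G : option 'I_k -> {set {set 'I_w}}) i (a : 'I_w) :
  outline t ls m G -> m <= a -> deg (G i) a = 0.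
Proof. case=> hp _ _ _; exact: active_graph_isolated (partition_sub i hp). Qed.

(** The difference is to be twice the number of loops of colour [i]. By the handshake lemma it has
    the parity of [cap t i * w], and [t = 1] makes [w] even. *)
Lemma outline_parity w k t ls m (G : option 'I_k -> {set {set 'I_w}}) i :
  t <= 1 -> w = 2 * k + t + 1 -> m <= w -> outline t ls m G ->
  ~~ odd (cap t i * (w - m) - \sum_(z in below w m) (cap t i - deg (G i) z)).
Proof.
move=> t1 wE mw oG; case: (oG) => hp hd hs _; have := hs i.
have : \sum_(z in below w m) (cap t i - deg (G i) z) + \sum_(z in below w m) deg (G i) z
        = m * cap t i.
  rewrite -big_split (eq_bigr (fun _ => cap t i)) => [|z _]; last by rewrite /= subnK.
  by rewrite sum_nat_const card_below.
have := handshake (outline_simple i oG).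
rewrite (bigID (mem (below w m))) /= [X in _ + X]big1 ?addn0 => [->|z]; last first.
  by rewrite inE -leqNgt => /(outline_isolated i oG).
move: (\sum_(z in _) _) => S; case: i => [i|] /=; last by nia.
by lia.
Qed.

Lemma sum_below w m (mw : m <= w) (P : pred 'I_w) (F : 'I_w -> nat) :
  \sum_(z in below w m | P z) F z = \sum_(z < m | P (widen_ord mw z)) F (widen_ord mw z).
Proof.
rewrite -(big_ord_narrow_cond mw); apply: eq_bigl => z.
by rewrite inE andbC.
Qed.

Lemma cap_le2 k t (i : option 'I_k) : t <= 1 -> cap t i <= 2.
Proof. by case: i => //= /leqW. Qed.

(** Bounds the free half-edges per component for cycle colours and leave alike. [root] names each
    component by a vertex, as the argument [r] of [balanced_selection] requires. *)
Lemma sum_comp_free w (H : {set {set 'I_w}}) c (A : {set 'I_w}) y : simple_graph H ->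
  c <= 2 -> (forall z, deg H z <= c) ->
  \sum_(z in A | root (adj H) z == y) (c - deg H z) <= 2.
Proof.
move=> sH c2 d; apply: (@leq_trans (stubs H y)).
  rewrite /stubs big_mkcond [X in _ <= X]big_mkcond; apply: leq_sum => z _.
  case: andP => [[_ /eqP E]|_]; last by [].
  by rewrite inE connect_adj_sym -E connect_root; lia.
by case: (stubs_02 sH (fun z => leq_trans (d z) c2) y) => ->.
Qed.

(** The last conjunct is the room condition after the step: it is the lower bound of
    [balanced_selection] with the number of loops eliminated. *)
Lemma outline_select w k t ls m (G : option 'I_k -> {set {set 'I_w}}) :
  t <= 1 -> w = 2 * k + t + 1 -> m.+1 < w -> outline t ls m G ->
  exists c : 'I_w -> option 'I_k,
  [/\ {in below w m, forall z, deg (G (c z)) z < cap t (c z)},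
      {in below w m &, forall y z, y != z -> c y = c z -> z \notin comp (G (c y)) y},
      forall i, #|[set z in below w m | c z == i]| <= cap t i
    & forall i, \sum_(z in below w m) (cap t i - deg (G i) z) + 2 * cap t i <=
        2 * #|[set z in below w m | c z == i]| + cap t i * (w - m)].
Proof.
move=> t1 wE mw oG; have mw' : m <= w by lia.
pose W := widen_ord mw'; pose n := w - m.
pose S i := \sum_(z in below w m) (cap t i - deg (G i) z).
pose l i := (n * cap t i - S i)./2.
pose s i (z : 'I_m) := cap t i - deg (G i) (W z).
have [_ hd hs hc] := oG.
have l2 i : S i + 2 * l i = n * cap t i.
  have := outline_parity i t1 wE mw' oG; have := hs i.
  by rewrite -/(S i) -/n mulnC /l; lia.
have sz (z : 'I_m) : \sum_i s i z = n by apply: (outline_free wE mw' oG); exact: (ltn_ord z).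
have sS i : \sum_z s i z = S i.
  rewrite /S -(sum_below mw' predT (fun z => cap t i - deg (G i) z)).
  by apply: eq_bigl => z; rewrite andbT.
have total : \sum_i 2 * l i = n * n.-1.
  have : \sum_i (S i + 2 * l i) = \sum_i n * @cap k t i by exact: eq_bigr.
  rewrite big_split /= -[X in _ = X]big_distrr /= sum_cap.
  have -> : \sum_i S i = m * n.
    under eq_bigr do rewrite -sS.
    by rewrite exchange_big /= (eq_bigr (fun _ => n)) // sum_nat_const card_ord.
  have -> : 2 * k + t = m + n.-1 by rewrite /n; lia.
  by rewrite mulnDr mulnC => /addnI.
have [|||c0 [c1 c2 c3 c4]] := @balanced_selection _ _ 'I_w (cap t) l s
    (fun i z => root (adj (G i)) (W z)) n _ sz _ _ total.
- by rewrite /n; lia.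
- move=> i y; rewrite /s -(sum_below mw' (fun z => root (adj (G i)) z == y)
    (fun z => cap t i - deg (G i) z)).
  exact: sum_comp_free (outline_simple i oG) (cap_le2 _ t1) (hd i).
- by move=> i; rewrite sS.
(* Vertices not yet active get the dummy colour [None]; the conclusions only concern [below w m]. *)
pose c (y : 'I_w) := oapp c0 None (insub (val y)).
have cW z : c (W z) = c0 z by rewrite /c /= valK.
have inW y : y \in below w m -> exists z, y = W z.
  by rewrite inE => ym; exists (Ordinal ym); apply: val_inj.
have cardS i : #|[set z in below w m | c z == i]| = #|[set z | c0 z == i]|.
  rewrite -!sum1_card; rewrite (eq_bigl (fun z => (z \in below w m) && (c z == i))); last first.
    by move=> z; rewrite inE.
  by rewrite (sum_below mw'); apply: eq_bigl => z; rewrite inE cW.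
exists c; split.
- by move=> y /inW[z ->]; rewrite cW; have := c1 z; rewrite subn_gt0.
- move=> _ _ /inW[y ->] /inW[z ->]; rewrite !cW => yz cyz.
  have /c2/(_ cyz) : y != z by apply: contra yz => /eqP->.
  by rewrite inE (root_connect (connect_adj_sym _)).
- by move=> i; rewrite cardS.
- move=> i; rewrite cardS -/(S i) mulnC -/n; have := c4 i; have := l2 i; lia.
Qed.

Lemma outline_step w k t ls m (G : option 'I_k -> {set {set 'I_w}}) :
  t <= 1 -> w = 2 * k + t + 1 -> m.+1 < w -> outline t ls m G ->
  exists G' : option 'I_k -> {set {set 'I_w}}, outline t ls m.+1 G'.
Proof.
move=> t1 wE mw oG; have [c [c1 c2 c3 c4]] := outline_select t1 wE mw oG.
have [hp hd hs hc] := oG.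
pose a : 'I_w := Ordinal (ltnW mw).
pose S i := [set y in below w m | c y == i].
have aS i : a \notin S i by rewrite !inE /= ltnn.
have da i : deg (G i) a = 0 by apply: (outline_isolated i oG).
have dE i z : deg (star a (S i) :|: G i) z = (if z == a then #|S i| else z \in S i) + deg (G i) z.
  by rewrite deg_setU ?deg_star // disjoint_sym disjoint_star.
exists (fun i => star a (S i) :|: G i); split.
- exact: partition_star.
- move=> i z; rewrite dE; case: eqP => [->|_]; first by rewrite da addn0 c3.
  case: (boolP (z \in S i)) => [|_]; last exact: hd.
  by rewrite inE => /andP[zm /eqP <-]; apply: c1.
- move=> i; have E : below w m.+1 = a |: below w m.
    by apply/setP=> z; rewrite !inE ltnS leq_eqVlt.
  rewrite E big_setU1 /=; last by rewrite inE /= ltnn.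
  rewrite dE eqxx da addn0; set T := \sum_(_ in _) _.
  have : T + #|S i| = \sum_(z in below w m) (cap t i - deg (G i) z).
    have -> : #|S i| = \sum_(z in below w m) (z \in S i).
      rewrite -sum1_card [LHS]big_mkcond [RHS]big_mkcond /=; apply: eq_bigr => z _.
      by case: (boolP (z \in S i)) => [/setIdP[->]|_] //; case: ifP.
    rewrite -big_split; apply: eq_bigr => z zm /=.
    rewrite dE; have -> : z == a = false.
      by apply/negP=> /eqP E'; rewrite E' inE /= ltnn in zm.
    case: (boolP (z \in S i)) => [|_]; last by rewrite addn0.
    rewrite inE => /andP[_ /eqP ci]; have := c1 z zm; rewrite ci; lia.
  (* Each choice of colour [i] removes one free half-edge from an old vertex and one of the
     [cap t i] that the new vertex brings; this is why [c4] counts the choices twice. *)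
  have := c4 i; have := c3 i; rewrite -/(S i).
  have -> : w - m = (w - m.+1).+1 by lia.
  rewrite mulnS; move: T (\sum_(_ in _) _) => T T' ? ? ?; lia.
- move=> i; rewrite cs_star_join //.
  + exact: outline_simple oG.
  + exact: c3.
  + by move=> z; rewrite inE => /andP[zm /eqP ci]; have := c1 z zm; rewrite ci.
  + move=> y z; rewrite inE => /andP[ym /eqP cy]; rewrite inE => /andP[zm /eqP cz] yz.
    by have := c2 y z ym zm yz; rewrite cy cz; apply.
Qed.

(** Each old vertex has one free half-edge left, so its colour is forced. The room condition allows
    at most [cap t i] choices of colour [i], and the total count makes this an equality. *)
Lemma outline_last w k t ls m (G : option 'I_k -> {set {set 'I_w}}) :
  t <= 1 -> w = 2 * k + t + 1 -> w = m.+1 -> outline t ls m G ->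
  exists G' : option 'I_k -> {set {set 'I_w}},
  [/\ forall e, \sum_i (e \in G' i) = (e \in Kv w),
      forall i z, deg (G' i) z = cap t i
    & forall i, exists q, perm_eq (cs (G' (Some i))) (q :: ls)].
Proof.
move=> t1 wE wm oG; have [hp hd hs hc] := oG.
have mw : m < w by lia.
pose s i z := cap t i - deg (G i) z.
have sz z : z \in below w m -> \sum_i s i z = 1.
  by rewrite inE => zm; rewrite (outline_free wE (ltnW mw) oG zm); lia.
pose c z := odflt None [pick i | 0 < s i z].
have sc z i : z \in below w m -> s i z = (c z == i).
  move=> /sz; rewrite /c; case: pickP => [j sj|h] /=; last first.
    by rewrite big1 // => j _; have := h j; lia.
  rewrite (bigD1 j) //=; case: eqP => [<-|/eqP ji]; first by lia.
  rewrite (bigD1 i) /=; last by rewrite eq_sym.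
  by rewrite /s in sj *; lia.
pose a : 'I_w := Ordinal mw.
pose S i := [set y in below w m | c y == i].
have aS i : a \notin S i by rewrite !inE /= ltnn.
have da i : deg (G i) a = 0 by apply: (outline_isolated i oG).
have dE i z : deg (star a (S i) :|: G i) z = (if z == a then #|S i| else z \in S i) + deg (G i) z.
  by rewrite deg_setU ?deg_star // disjoint_sym disjoint_star.
have cS i : #|S i| = \sum_(z in below w m) s i z.
  rewrite -sum1_card [LHS]big_mkcond [RHS]big_mkcond /=; apply: eq_bigr => z _.
  by rewrite inE; case: (boolP (_ \in _)) => //= zm; rewrite sc //; case: (_ == _).
have cS1 i : #|S i| <= cap t i.
  by rewrite cS; apply: leq_trans (hs i) _; rewrite wm subSnn muln1.
have cS2 i : #|S i| = cap t i.
  apply/eqP; rewrite eqn_leq cS1 /=.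
  have : \sum_i #|S i| = \sum_i @cap k t i.
    under eq_bigr do rewrite cS.
    rewrite exchange_big /= (eq_bigr (fun _ => 1)) // sum_cap sum1_card card_below; lia.
  rewrite (bigD1 i) //= [X in _ = X -> _](bigD1 i) //=.
  set T := \sum_(j | j != i) #|_|.
  have : T <= \sum_(j | j != i) cap t j by exact: leq_sum.
  move: T (\sum_(_ | _) _) (#|_|) => T T' q; lia.
have notlast z : z != a -> z \in below w m.
  by rewrite inE -val_eqE /=; have := ltn_ord z; lia.
exists (fun i => star a (S i) :|: G i); split.
- move=> e; rewrite (partition_star c _ hp) // !inE; congr (nat_of_bool _).
  case: (_ == _) => //=; apply/subsetP=> z _; rewrite inE -wm; exact: ltn_ord.
- move=> i z; rewrite dE; case: eqP => [->|/eqP za]; first by rewrite da addn0 cS2.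
  have zm := notlast z za; have := sc z i zm; have := hd i z.
  by rewrite [z \in S i]inE zm /s; case: (_ == _) => /=; lia.
- move=> i; have sG := outline_simple (Some i) oG.
  have dS : {in S (Some i), forall z, deg (G (Some i)) z = 1}.
    move=> z; rewrite inE => /andP[zm ci]; have := sc z (Some i) zm.
    by rewrite ci /s /=; lia.
  have [] := @cs_star_close _ (G (Some i)) a (S (Some i)) sG (hd (Some i)) (da _) (aS _) (cS2 _) dS.
    (* A free end [z] off the path of [y] would be a third free half-edge, beside the two of that
       path, in a colour of capacity two. *)
    move=> y z yS zS; apply/negPn/negP => nzy.
    have sy : stubs (G (Some i)) y = 2 by apply: (stubs_free sG (hd (Some i))); rewrite dS.
    have : stubs (G (Some i)) y + 1 <= 2; last by rewrite sy.
    apply: leq_trans (cS1 (Some i)); rewrite cS.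
    have zm : z \in below w m by move: zS; rewrite inE => /andP[].
    have ya : a \notin comp (G (Some i)) y.
      apply/negP=> /comp_eq; rewrite comp_isolated // => E.
      have := comp_refl (G (Some i)) y; rewrite -E inE => /eqP ya.
      by have := dS y yS; rewrite ya da.
    rewrite (bigD1 z) //= addnC leq_add //; first by rewrite /s dS.
    rewrite /stubs big_mkcond [X in _ <= X]big_mkcond; apply: leq_sum => u _.
    case: ifP => // uy; rewrite notlast /=; last by apply: contra ya => /eqP <-.
    by have -> : u != z by apply: contra nzy => /eqP <-.
  by move=> q hq; exists q; apply: perm_trans hq _; rewrite perm_cons.
Qed.

Lemma outline_complete w k t ls m (G : option 'I_k -> {set {set 'I_w}}) :
  t <= 1 -> w = 2 * k + t + 1 -> m < w -> outline t ls m G ->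
  exists G' : option 'I_k -> {set {set 'I_w}},
  [/\ forall e, \sum_i (e \in G' i) = (e \in Kv w),
      forall i z, deg (G' i) z = cap t i
    & forall i, perm_eq (cs (G' (Some i))) (w - sumn ls :: ls)].
Proof.
move=> t1 wE mw; have [d dE] : exists d, w = m + d.+1 by exists (w - m.+1); lia.
elim: d m G dE {mw} => [|d IH] m G dE oG.
  have [|G' [h1 h2 h3]] := outline_last t1 wE _ oG; first by lia.
  exists G'; split=> // i; have [q hq] := h3 i.
  have := sumn_cs (G' (Some i)); rewrite two_regular_cover => [|x]; last exact: h2.
  by rewrite cardsT card_ord (perm_sumn hq) /= => qE; have -> : w - sumn ls = q by lia.
have [|G' oG'] := outline_step t1 wE _ oG; first by lia.
by apply: IH oG'; lia.
Qed.

(** * Embedding into a larger vertex set *)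

Definition map_graph v w (f : 'I_v -> 'I_w) (G : {set {set 'I_v}}) : {set {set 'I_w}} :=
  [set f @: e | e : {set 'I_v} in G].

Lemma mem_map_graph v w (f : 'I_v -> 'I_w) (G : {set {set 'I_v}}) (e : {set 'I_v}) :
  injective f -> (f @: e \in map_graph f G) = (e \in G).
Proof. by move=> fi; rewrite mem_imset //; apply: imset_inj. Qed.

Lemma deg_map_graph v w (f : 'I_v -> 'I_w) (G : {set {set 'I_v}}) x :
  injective f -> deg (map_graph f G) (f x) = deg G x.
Proof.
move=> fi; rewrite /deg -[RHS](card_imset _ (imset_inj fi)); apply: eq_card => e.
apply/setIdP/imsetP => [[/imsetP[e' eG ->]]|[e']].
  by rewrite mem_imset // => xe; exists e' => //; rewrite inE eG.
by case/setIdP=> eG xe ->; rewrite mem_map_graph // mem_imset.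
Qed.

Lemma deg_map_graph_out v w (f : 'I_v -> 'I_w) (G : {set {set 'I_v}}) y :
  (forall x, y != f x) -> deg (map_graph f G) y = 0.
Proof.
move=> h; apply: eq_card0 => e; rewrite inE; apply/negP=> /andP[/imsetP[e' _ ->] /imsetP[x _ E]].
by have := h x; rewrite E eqxx.
Qed.

Lemma adj_map_graph v w (f : 'I_v -> 'I_w) (G : {set {set 'I_v}}) x y :
  injective f -> adj (map_graph f G) (f x) (f y) = adj G x y.
Proof.
move=> fi; rewrite /adj (inj_eq fi) -(mem_map_graph G _ fi).
by rewrite imsetU1 imset_set1.
Qed.

Lemma comp_map_graph v w (f : 'I_v -> 'I_w) (G : {set {set 'I_v}}) x :
  injective f -> comp (map_graph f G) (f x) = f @: comp G x.
Proof.
move=> fi; apply/setP=> y; rewrite inE; apply/idP/imsetP.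
  case/connectP=> p; elim/last_ind: p y => [|p z IH] y /=.
    by move=> _ ->; exists x; rewrite ?comp_refl.
  rewrite rcons_path last_rcons => /andP[/IH/(_ erefl)[u ux ->] /[swap] ->].
  move=> uz; case/andP: (uz) => _ /imsetP[e eG E].
  have /imsetP[u' _ zE] : z \in f @: e by rewrite -E set22.
  exists u' => //; move: uz; rewrite zE adj_map_graph // => /connect1 uu.
  by move: ux; rewrite !inE => /connect_trans; apply.
case=> z + ->; rewrite inE => /connectP[p pp ->].
elim/last_ind: p pp => [|p u IH]; first by rewrite connect0.
rewrite rcons_path last_rcons => /andP[/IH h e].
by apply: connect_trans h _; apply: connect1; rewrite adj_map_graph.
Qed.

(** Vertices outside the image are isolated, hence never form a cycle component. *)
Lemma cs_map_graph v w (f : 'I_v -> 'I_w) (G : {set {set 'I_v}}) :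
  injective f -> perm_eq (cs (map_graph f G)) (cs G).
Proof.
move=> fi; have cI : cycle_comps (map_graph f G) = [set f @: C | C : {set 'I_v} in cycle_comps G].
  apply/setP=> C; apply/setIdP/imsetP.
    case=> /imsetP[y _ ->] /forall_inP h.
    have /existsP[x /eqP yx] : [exists x, y == f x].
      apply: contraT; rewrite negb_exists => /forallP /(deg_map_graph_out G) d0.
      by have := h y (comp_refl _ y); rewrite d0.
    exists (comp G x); last by rewrite yx comp_map_graph.
    rewrite inE imset_f //=; apply/forall_inP=> z zx.
    by rewrite -(deg_map_graph _ _ fi); apply: h; rewrite yx comp_map_graph // imset_f.
  case=> C' /setIdP[/imsetP[x _ ->] /forall_inP h] ->; split.
    by rewrite -comp_map_graph // imset_f.
  by apply/forall_inP=> _ /imsetP[z zx ->]; rewrite deg_map_graph // h.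
have E : perm_eq (enum (cycle_comps (map_graph f G)))
    [seq f @: (C : {set 'I_v}) | C <- enum (cycle_comps G)].
  apply: uniq_perm; rewrite ?enum_uniq ?(map_inj_uniq (imset_inj fi)) ?enum_uniq //.
  move=> C; rewrite mem_enum cI; apply/imsetP/mapP => -[C' h ->]; exists C' => //.
    by rewrite mem_enum.
  by rewrite mem_enum in h.
rewrite /cs; apply: perm_trans (perm_map _ E) _.
rewrite -map_comp (@eq_map _ _ _ (fun C : {set 'I_v} => #|C|)) // => C.
exact: card_imset.
Qed.

(** * Halvings *)

Lemma two_regularP v (G : {set {set 'I_v}}) :
  reflect (simple_graph G /\ forall x, deg G x = 2) (two_regular G).
Proof.
apply: (iffP andP) => -[sG h]; split=> //; first by move=> x; apply/eqP/(forallP h).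
by apply/forallP=> x; rewrite h.
Qed.

Lemma deg_setD v (G h : {set {set 'I_v}}) x :
  h \subset G -> deg G x = deg h x + deg (G :\: h) x.
Proof.
move=> s; rewrite -deg_setU; last first.
  by rewrite disjoints_subset setCD subsetUr.
by rewrite setDE setUIr setUCr setIT (setUidPr s).
Qed.

Lemma comp_sub_eq v (G h : {set {set 'I_v}}) x : h \subset G ->
  {in comp h x, forall z, deg h z = deg G z} -> comp h x = comp G x.
Proof.
move=> hG d; have sub : subrel (adj h) (adj G).
  by move=> y z /andP[yz e]; rewrite /adj yz (subsetP hG).
apply/setP=> y; rewrite !inE; apply/idP/idP.
  by apply: connect_sub => p q /sub/connect1.
case/connectP=> p; elim/last_ind: p y => [|p z IH] y /=; first by move=> _ ->; rewrite connect0.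
rewrite rcons_path last_rcons => /andP[/IH/(_ erefl) h1 /andP[uz e] ->].
apply: (connect_trans h1 (connect1 _)); rewrite /adj uz /=.
set u := last x p in h1 uz e *.
have ux : u \in comp h x by rewrite inE.
have sE : [set f in h | u \in f] \subset [set f in G | u \in f].
  by apply/subsetP=> f; rewrite !inE => /andP[/(subsetP hG)-> ->].
have : [set f in h | u \in f] == [set f in G | u \in f].
  by rewrite eqEcard sE /= -[X in X <= _]/(deg G u) -[X in _ <= X]/(deg h u) d.
by move/eqP/setP/(_ [set u; z]); rewrite !inE e eqxx /= andbT.
Qed.

(** On a cycle of [h] the edges of [h] already exhaust the degree in [G], so no edge of [G] leaves
    it. *)
Lemma cycle_comps_sub v (G h : {set {set 'I_v}}) (C : {set 'I_v}) : h \subset G ->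
  (forall x, deg G x = 2) ->
  (C \in cycle_comps h) = (C \in cycle_comps G) && [forall x in C, deg h x == 2].
Proof.
move=> hG dG; apply/idP/andP => [|[]].
  rewrite inE => /andP[/imsetP[x _ ->] d]; split=> //.
  rewrite (comp_sub_eq hG) => [|z zx]; last by rewrite dG; apply/eqP/(forall_inP d).
  by rewrite inE imset_f //; apply/forall_inP=> y _; rewrite dG.
rewrite inE => /andP[/imsetP[x _ ->] _] d.
have E : comp h x = comp G x.
  apply: comp_sub_eq => // z zx; rewrite dG; apply/eqP/(forall_inP d).
  move: zx; rewrite !inE; apply: connect_sub => p q /andP[pq e].
  by apply: connect1; rewrite /adj pq (subsetP hG).
by rewrite -E inE imset_f //= E.
Qed.

Lemma perm_map_lift (T : eqType) (S : eqType) (x0 : T) (g : T -> S) (s : seq T) (u : seq S) :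
  perm_eq (map g s) u -> exists2 s', perm_eq s s' & map g s' = u.
Proof.
rewrite perm_sym => /(perm_iotaP (g x0))[Is pI uE]; exists (map (nth x0 s) Is).
  by rewrite size_map in pI; rewrite perm_sym -{2}(mkseq_nth x0 s) perm_map.
rewrite uE -map_comp; apply/eq_in_map=> i; rewrite (perm_mem pI) mem_iota size_map add0n => /andP[_ h].
by rewrite /= (nth_map x0).
Qed.

(** The cycles are listed as the [x]-cycle [C0] and two batches [s1], [s2], each of lengths [ls].
    The half [h] receives [s1] and a single edge [e0] of [C0]; the complement receives [s2] and the
    rest of [C0]. An end of [e0] has degree one in both halves, so [C0] is a cycle in neither. *)
Lemma exists_halving v (G : {set {set 'I_v}}) x ls :
  0 < x -> two_regular G -> perm_eq (cs G) (x :: ls ++ ls) ->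
  exists h, halving ls G h.
Proof.
move=> x0 /two_regularP[sG dG] /(perm_map_lift set0)[[|C0 s] // ps [C0x sE]].
pose s1 := take (size ls) s; pose s2 := drop (size ls) s.
have m1 : [seq #|C| | C : {set 'I_v} <- s1] = ls by rewrite /s1 map_take sE take_size_cat.
have m2 : [seq #|C| | C : {set 'I_v} <- s2] = ls by rewrite /s2 map_drop sE drop_size_cat.
have us : uniq (C0 :: s1 ++ s2) by rewrite cat_take_drop -(perm_uniq ps) enum_uniq.
have ms C : (C \in cycle_comps G) = (C \in C0 :: s1 ++ s2).
  by rewrite cat_take_drop -(perm_mem ps) mem_enum.
move: us; rewrite cons_uniq cat_uniq mem_cat negb_or => /and3P[/andP[n1 n2] u1 /andP[/hasPn n12 u2]].
have CE C z : C \in cycle_comps G -> z \in C -> C = comp G z.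
  by case/cycle_compsP=> y -> _ /comp_eq->.
pose U := [set z | comp G z \in s1].
have UE z : (z \in U) = (comp G z \in s1) by rewrite inE.
have [p pC] : exists p, p \in C0 by apply/card_gt0P; rewrite C0x.
have C0E : C0 = comp G p by apply: CE => //; rewrite ms mem_head.
have [e0 e0G pe0] : exists2 e, e \in G & p \in e.
  have : 0 < deg G p by rewrite dG.
  by case/card_gt0P=> e /setIdP[]; exists e.
have edge_comp e y z : e \in G -> y \in e -> z \in e -> comp G y = comp G z.
  move=> eG ye ze; have /eqP/cards2P[a [b [ab E]]] := (simple_graphP _ sG) e eG.
  have cab : comp G b = comp G a by apply/comp_eq/edge_in_comp; rewrite -?E.
  by move: ye ze; rewrite E !in_set2 => /orP[]/eqP-> /orP[]/eqP->; rewrite ?cab.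
have s1G C : C \in s1 -> C \in cycle_comps G by move=> h; rewrite ms in_cons mem_cat h orbT.
have s2G C : C \in s2 -> C \in cycle_comps G by move=> h; rewrite ms in_cons mem_cat h !orbT.
have eU e y : e \in G -> y \in e -> (e \subset U) = (y \in U).
  move=> eG ye; apply/subsetP/idP => [|yU z ze]; first exact.
  by rewrite UE (edge_comp e z y) // -UE.
have pU : p \notin U by rewrite UE -C0E.
pose h := e0 |: [set e in G | e \subset U].
have hG : h \subset G.
  by apply/subsetP=> e; rewrite in_setU1 => /orP[/eqP->//|/setIdP[]].
have e0h : e0 \in h by rewrite setU11.
have dh y : deg h y = if y \in U then 2 else y \in e0.
  rewrite /deg; case: ifPn => yU.
    rewrite -(dG y); apply: eq_card => e; rewrite !inE.
    case: (boolP (y \in e)) => ye; rewrite ?andbF // !andbT.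
    apply/orP/idP => [[/eqP->//|/andP[]//]|eG]; right.
    by rewrite eG (eU e y).
  case: (boolP (y \in e0)) => ye0.
    rewrite /= -(cards1 e0); apply: eq_card => e; rewrite !inE.
    apply/andP/eqP => [[/orP[/eqP//|/andP[eG eSU]] ye]|->]; last by rewrite eqxx.
    by rewrite (eU e y) // (negbTE yU) in eSU.
  apply: eq_card0 => e; rewrite !inE; apply/negP=> /andP[/orP[/eqP->|/andP[eG eSU]] ye].
    by rewrite ye in ye0.
  by rewrite (eU e y) // (negbTE yU) in eSU.
have dh' y : deg (G :\: h) y = if y \in U then 0 else 2 - (y \in e0).
  have -> : deg (G :\: h) y = 2 - deg h y by rewrite -(dG y) (deg_setD y hG) addKn.
  by rewrite dh; case: ifP.
have perm_cs (H : {set {set 'I_v}}) (r : seq {set 'I_v}) :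
    uniq r -> cycle_comps H =i r -> [seq #|C| | C : {set 'I_v} <- r] = ls -> perm_eq (cs H) ls.
  move=> ur hr <-; apply/perm_map/uniq_perm; rewrite ?enum_uniq //.
  by move=> C; rewrite mem_enum hr.
exists h; rewrite /halving hG /=; apply/andP; split.
- apply: (perm_cs _ s1) => // C; rewrite (cycle_comps_sub _ hG) //.
  apply/andP/idP => [[CG /forall_inP d]|Cs].
    have /cycle_compsP[y Ey _] := CG; have yC : y \in C by rewrite Ey comp_refl.
    have := d y yC; rewrite dh UE -Ey; case: ifP => // _.
    by case: (_ \in _).
  split; first exact: s1G.
  by apply/forall_inP=> y yC; rewrite dh UE -(CE C) ?s1G // Cs.
- apply: (perm_cs _ s2) => // C; rewrite (cycle_comps_sub _ (subsetDl _ _)) //.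
  apply/andP/idP => [[CG /forall_inP d]|Cs].
    move: (CG); rewrite ms in_cons mem_cat => /or3P[/eqP CE0|Cs|//].
      have := d p; rewrite CE0 => /(_ pC); rewrite dh' (negbTE pU) pe0 //.
    have /cycle_compsP[y Ey _] := CG; have yC : y \in C by rewrite Ey comp_refl.
    by have := d y yC; rewrite dh' UE -Ey Cs.
  split; first exact: s2G.
  apply/forall_inP=> y yC; have yE := CE C y (s2G _ Cs) yC.
  rewrite dh' UE -yE (negbTE (n12 C Cs)); case: (boolP (y \in e0)) => // ye0.
  by rewrite C0E (edge_comp e0 p y) // -yE Cs in n2.
Qed.

Lemma sum_free_cover v (h : {set {set 'I_v}}) :
  \sum_z (2 - deg h z) = \sum_(z in ~: cover (cycle_comps h)) (2 - deg h z).
Proof.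
rewrite (bigID (mem (cover (cycle_comps h)))) /= big1 => [|z /deg_cycle-> //].
by rewrite add0n; apply: eq_bigl => z; rewrite inE.
Qed.

(* Each half contains an edge of the [x]-cycle. *)
Lemma halving_free v (G h : {set {set 'I_v}}) x ls :
  0 < x -> v = x + 2 * sumn ls -> two_regular G -> halving ls G h ->
  \sum_z (2 - deg h z) + 2 <= 2 * (v - sumn ls).
Proof.
move=> x0 vE /two_regularP[sG dG] /andP[/andP[hG c1] c2].
have sh := simple_graph_sub hG sG.
rewrite sum_free_cover; set U := cover _.
have cU : #|U| = sumn ls by rewrite -sumn_cs (perm_sumn c1).
have cUC : #|~: U| = v - sumn ls by rewrite cardsCs setCK cU card_ord.
case: (boolP [exists z in ~: U, 0 < deg h z]) => [/exists_inP[z zU dz]|].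
  have /card_gt0P[y] : 0 < #|[set y | adj h z y]| by rewrite -deg_adj.
  rewrite inE => zy; have [zy' e] := andP zy.
  have yU : y \in ~: U.
    rewrite inE -mem_cycle_comps; rewrite inE -mem_cycle_comps in zU.
    by rewrite (comp_eq (edge_in_comp zy' e)).
  have dy : 0 < deg h y.
    by apply/card_gt0P; exists [set z; y]; rewrite inE e set22.
  rewrite -cUC mulnC -sum_nat_const (bigD1 z) // (bigD1 y) /=; last by rewrite yU eq_sym.
  rewrite [X in _ <= X](bigD1 z) // [X in _ <= _ + X](bigD1 y) /=; last by rewrite yU eq_sym.
  set S1 := \sum_(_ | _) _; set S2 := \sum_(_ | _) 2.
  have S12 : S1 <= S2 by apply: leq_sum => u _; exact: leq_subr.
  by clear -dz dy S12; lia.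
(* If [h] had no edge off its cycles, [G :\: h] would be two-regular there, and its cycles would
   cover [x + sumn ls] vertices instead of [sumn ls]. *)
rewrite negb_exists_in => /forall_inP d0.
have dD z : deg (G :\: h) z = 2 - deg h z by rewrite -(dG z) (deg_setD z hG) addKn.
have d0' z : z \notin U -> deg (G :\: h) z = 2.
  by move=> zU; have := d0 z; rewrite inE zU dD lt0n negbK => /(_ isT)/eqP->.
have d2' z : z \in U -> deg (G :\: h) z = 0 by move=> /deg_cycle dz; rewrite dD dz.
have : #|~: U| <= #|cover (cycle_comps (G :\: h))|.
  apply/subset_leq_card/subsetP=> z; rewrite inE => zU.
  rewrite -mem_cycle_comps inE imset_f //=; apply/forall_inP=> y zy; apply/eqP/d0'.
  apply/negP=> yU; have := comp_isolated (d2' y yU); rewrite (comp_eq zy) => E.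
  by have := comp_refl (G :\: h) z; rewrite E inE => /eqP zE; rewrite zE yU in zU.
by rewrite -sumn_cs (perm_sumn c2) cUC => H; exfalso; clear -x0 vE H; lia.
Qed.

Lemma halving_compl v (G h : {set {set 'I_v}}) ls :
  halving ls G h -> halving ls G (G :\: h).
Proof.
move=> /andP[/andP[hG c1] c2]; rewrite /halving subsetDl c2 /=.
suff -> : G :\: (G :\: h) = h by [].
by rewrite setDDr setDv set0U (setIidPr hG).
Qed.

(** * From solutions to outlines and back *)

Lemma count_nth_sum v (Hs : seq {set {set 'I_v}}) (e : {set 'I_v}) :
  count (fun H : {set {set 'I_v}} => e \in H) Hs = \sum_(i < size Hs) (e \in nth set0 Hs i).
Proof.
rewrite -sumn_count -[in LHS](mkseq_nth set0 Hs) /mkseq -map_comp sumnE big_map.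
by rewrite -(subn0 (size Hs)) -/(index_iota 0 _) big_mkord subn0.
Qed.

Lemma outline_embed v w t ls (Hs : seq {set {set 'I_v}}) (M : {set {set 'I_v}}) :
  v <= w ->
  (forall e : {set 'I_v},
    (e \in M) + count (fun H : {set {set 'I_v}} => e \in H) Hs = (e \in Kv v)) ->
  (forall z, deg M z = t) ->
  (forall H, H \in Hs -> [/\ forall z, deg H z <= 2,
     \sum_z (2 - deg H z) <= 2 * (w - v) & perm_eq (cs H) ls]) ->
  exists G : option 'I_(size Hs) -> {set {set 'I_w}}, outline t ls v G.
Proof.
move=> vw hp hM hH; pose f := widen_ord vw.
have fi : injective f by move=> p q /(congr1 val)/= /val_inj.
pose H (i : option 'I_(size Hs)) := if i is Some j then nth set0 Hs j else M.
have HP j : H (Some j) \in Hs by exact: mem_nth.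
have hd i z : deg (H i) z <= cap t i.
  case: i => [j|]; last by rewrite /= hM.
  by case: (hH _ (HP j)).
exists (fun i => map_graph f (H i)); split.
- move=> e; case: (boolP (e \subset below w v)) => [es|es].
    have [e' ->] : exists e' : {set 'I_v}, e = f @: e'.
      exists (f @^-1: e); apply/setP=> z; apply/idP/imsetP => [ze|[y]]; last first.
        by rewrite inE => ye ->.
      have zv : z < v by have := subsetP es z ze; rewrite inE.
      have zE : z = f (Ordinal zv) by apply: val_inj.
      by exists (Ordinal zv); rewrite // inE -zE.
    under eq_bigr do rewrite mem_map_graph //.
    rewrite sum_option /= -count_nth_sum hp !inE card_imset //.
    have -> : f @: e' \subset below w v.
      by apply/subsetP=> _ /imsetP[z _ ->]; rewrite inE /= ltn_ord.
    by rewrite andbT.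
  rewrite inE (negbTE es) andbF; apply: big1 => i _.
  case: imsetP => // -[e' _ E]; case/negP: es; rewrite E.
  by apply/subsetP=> _ /imsetP[z _ ->]; rewrite inE /= ltn_ord.
- move=> i z; case: (boolP [exists x, z == f x]) => [/existsP[x /eqP->]|].
    by rewrite deg_map_graph.
  by rewrite negb_exists => /forallP h; rewrite deg_map_graph_out.
- move=> i; rewrite (eq_bigl (fun z => (z \in below w v) && predT z)); last by move=> z; rewrite andbT.
  rewrite (sum_below vw) (eq_bigr (fun z => cap t i - deg (H i) z)); last first.
    by move=> z _; rewrite -[widen_ord vw z]/(f z) deg_map_graph.
  case: i => [j|]; last by rewrite big1 // => z _; rewrite /= hM subnn.
  by case: (hH _ (HP j)).
- by move=> i; apply: perm_trans (cs_map_graph _ fi) _; case: (hH _ (HP i)).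
Qed.

(** Old and new order have the same parity, so the completed colour [None] is empty or a 1-factor
    exactly as [is_Kstar] demands. *)
Lemma OP_solvable_embed v y ls (Hs : seq {set {set 'I_v}}) (M : {set {set 'I_v}}) :
  v < y + sumn ls ->
  y + sumn ls = 2 * size Hs + ~~ odd v + 1 ->
  odd (y + sumn ls) = odd v ->
  (forall e : {set 'I_v},
    (e \in M) + count (fun H : {set {set 'I_v}} => e \in H) Hs = (e \in Kv v)) ->
  (forall z, deg M z = ~~ odd v) ->
  (forall H, H \in Hs -> [/\ forall z, deg H z <= 2,
     \sum_z (2 - deg H z) <= 2 * (y + sumn ls - v) & perm_eq (cs H) ls]) ->
  OP_solvable (y :: ls).
Proof.
move=> vw wE ow hp hM hH.
have [G oG] := @outline_embed v (sumn (y :: ls)) _ ls Hs M (ltnW vw) hp hM hH.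
have [G' [h1 h2 h3]] := outline_complete (leq_b1 _) wE vw oG.
have sG i : simple_graph (G' i).
  apply: simple_graph_sub (partition_sub i h1) _.
  by apply/simple_graphP=> e; rewrite inE => /eqP.
exists [seq G' (Some i) | i <- enum 'I_(size Hs)]; split=> //; split.
- exists (Kv _ :\: G' None); split.
    rewrite /is_Kstar; case: ifPn => ov.
      suff -> : G' None = set0 by rewrite setD0.
      apply/setP=> e; rewrite in_set0; apply/negP=> eG.
      have /eqP/cards2P[a [b [ab E]]] := (simple_graphP _ (sG None)) e eG.
      have da : deg (G' None) a = 0 by rewrite h2 /= -ow ov.
      by have := deg_eq0 da eG; rewrite E set21.
    exists (G' None); split=> //; rewrite /perfect_matching sG /=.
    by apply/forallP=> z; rewrite h2 /= -ow ov.
  move=> e; rewrite count_map -sumn_count [LHS]sumnE big_map big_enum /=.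
  have := h1 e; rewrite sum_option in_setD.
  by move: (\sum_(_ | _) _) (e \in G' None) (e \in Kv _) => S [] [] /=; lia.
- move=> _ /mapP[i _ ->]; split.
    by apply/two_regularP; split=> // x; rewrite h2.
  by have := h3 i; rewrite /= addnK.
Qed.

Lemma deg_Kv v (z : 'I_v) : deg (Kv v) z = v.-1.
Proof.
rewrite -(@deg_active v v z) //; apply: eq_card => e; rewrite !inE.
suff -> : e \subset below v v by rewrite andbT.
by apply/subsetP=> y _; rewrite inE.
Qed.

(** The leave is empty or the removed 1-factor; the number of 2-factors is read off the degree of
    one vertex in the complete graph. *)
Lemma OP_solution_leave v ms (Gs : seq {set {set 'I_v}}) :
  0 < v -> OP_solution ms Gs ->
  exists M : {set {set 'I_v}},
  [/\ forall e : {set 'I_v},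
        (e \in M) + count (fun H : {set {set 'I_v}} => e \in H) Gs = (e \in Kv v),
      forall z, deg M z = ~~ odd v & v = 2 * size Gs + ~~ odd v + 1].
Proof.
move=> v0 [_ [[K [hK hc]] hG]].
have [M [h1 h2]] : exists M : {set {set 'I_v}},
    (forall e, (e \in M) + (e \in K) = (e \in Kv v)) /\ forall z, deg M z = ~~ odd v.
  move: hK; rewrite /is_Kstar; case: ifP => _.
    by move=> ->; exists set0; split=> [e|z]; rewrite ?in_set0 ?deg0.
  case=> M [/andP[sM dM] ->]; exists M; split=> [e|z]; last exact/eqP/(forallP dM).
  rewrite in_setD; case: (boolP (e \in M)) => //= eM.
  by rewrite inE ((simple_graphP _ sM) e eM).
have h3 e : (e \in M) + count (fun H : {set {set 'I_v}} => e \in H) Gs = (e \in Kv v).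
  by rewrite hc.
exists M; split=> //.
pose H (i : option 'I_(size Gs)) := if i is Some j then nth set0 Gs j else M.
have : \sum_i deg (H i) (Ordinal v0) = deg (Kv v) (Ordinal v0).
  by apply: sum_deg_partition => e; rewrite sum_option /= -count_nth_sum; apply: h3.
rewrite sum_option /= h2 deg_Kv (eq_bigr (fun _ => 2)) => [|i _].
  by rewrite sum_nat_const card_ord; lia.
by have [/two_regularP[_ ->]] := hG _ (mem_nth set0 (ltn_ord i)).
Qed.

Lemma perm_nth2 (T : eqType) (x0 : T) (s : seq T) i j : i < size s -> j < size s -> i != j ->
  exists r, perm_eq s (nth x0 s i :: nth x0 s j :: r).
Proof.
move=> hi hj ij; exists (map (nth x0 s) (rem j (rem i (iota 0 (size s))))).
rewrite -{1}(mkseq_nth x0 s) -!map_cons perm_map //.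
have iI : i \in iota 0 (size s) by rewrite mem_iota.
have jI : j \in rem i (iota 0 (size s)).
  by rewrite mem_rem_uniq ?iota_uniq // !inE eq_sym ij mem_iota.
by apply: perm_trans (perm_to_rem iI) _; rewrite perm_cons perm_to_rem.
Qed.

(** Any halving will do, so one is picked; the empty default does not arise for the 2-factors of a
    solution, by [exists_halving]. *)
Definition halves v ls (Gs : seq {set {set 'I_v}}) : seq {set {set 'I_v}} :=
  flatten [seq (if [pick h | halving ls G h] is Some h then [:: h; G :\: h] else [::])
          | G <- Gs].

Lemma count_split v (G h : {set {set 'I_v}}) (e : {set 'I_v}) :
  h \subset G -> (e \in h) + (e \in G :\: h) = (e \in G).
Proof.
move=> /subsetP s; rewrite in_setD.
by case: (boolP (e \in h)) => [/s->|_].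
Qed.

Lemma halvesP v x ls (Gs : seq {set {set 'I_v}}) :
  0 < x -> (forall G, G \in Gs -> two_regular G /\ perm_eq (cs G) (x :: ls ++ ls)) ->
  [/\ size (halves ls Gs) = 2 * size Gs,
      forall e : {set 'I_v}, count (fun H : {set {set 'I_v}} => e \in H) (halves ls Gs) =
                count (fun H : {set {set 'I_v}} => e \in H) Gs
    & forall H, H \in halves ls Gs -> exists2 G, G \in Gs & halving ls G H].
Proof.
move=> x0; elim: Gs => [|G Gs IH] hG; first by split.
have [|I1 I2 I3] := IH; first by move=> H HG; apply: hG; rewrite in_cons HG orbT.
have [tG pG] := hG G (mem_head _ _).
rewrite /halves /=; case: pickP => [h hh|none]; last first.
  by have [h hh] := exists_halving x0 tG pG; rewrite none in hh.
rewrite -/(halves ls Gs); split.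
- by rewrite /= I1; lia.
- have /andP[/andP[hsub _] _] := hh.
  by move=> e; rewrite /= I2 addnA count_split.
move=> H; rewrite !in_cons => /or3P[/eqP->|/eqP->|/I3[G' G'G hH]].
- by exists G; rewrite // mem_head.
- by exists G; rewrite ?mem_head ?halving_compl.
- by exists G'; rewrite // in_cons G'G orbT.
Qed.

(** In terms of [v], the order [w] is [2 * v - b - 1]. The bounds involving [w - 2] are those of the
    second case, and they imply the ones for the first. *)
Lemma target_orders x L g (b : bool) v : 3 <= x -> 3 <= L ->
  v = x + 2 * L -> v = 2 * g + b + 1 ->
  let w := 2 * x + 3 * L - (b + 1) + L in
  [/\ v < w - 2, w = 2 * (2 * g) + b + 1, odd w = odd v & 2 * v <= w - 2 + 4].
Proof. by move=> x3 L3 -> E /=; split; lia. Qed.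

Lemma target_order2 x L (b : bool) : 3 <= x -> 3 <= L ->
  2 * x + 3 * L - (b + 1) - 2 + L = 2 * x + 3 * L - (b + 1) + L - 2.
Proof. lia. Qed.

Theorem theorem3p1 (x : nat) (ls : seq nat)
  (Gs : seq {set {set 'I_(sumn (x :: ls ++ ls))}}) (eps : nat) :
  3 <= x -> 1 <= size ls -> all (fun l => 3 <= l) ls ->
  OP_solution (x :: ls ++ ls) Gs ->
  eps \in [:: 1; 2] -> eps = x %[mod 2] ->
  OP_solvable (2 * x + 3 * sumn ls - eps :: ls) /\
  (matching_property ls Gs ->
   OP_solvable (2 * x + 3 * sumn ls - eps - 2 :: ls)).
Proof.
move=> x3 ls0 ls3 sol epsE epsx.
set v := sumn (x :: ls ++ ls) in Gs sol *.
have vE : v = x + 2 * sumn ls by rewrite /v /= sumn_cat; lia.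
have L3 : 3 <= sumn ls.
  by case: (ls) ls0 ls3 => //= l s _ /andP[l3 _]; lia.
have ov : odd v = odd x by rewrite vE; lia.
have eE : eps = ~~ odd v + 1.
  rewrite ov; move: epsE epsx; rewrite !inE => /orP[]/eqP->; rewrite !modn2 /=; lia.
have x0 : 0 < x by exact: leq_trans x3.
have v0 : 0 < v by rewrite vE ltn_addr.
have [M [hp hM vG]] := OP_solution_leave v0 sol.
have [_ [_ hG]] := sol.
have [] := target_orders x3 L3 vE vG; rewrite {}eE {epsE epsx}.
set w := 2 * x + _ - _ + _ => w1 w2 w3 w4.
(* Room for a half when the target order is [n]: there are at least [v - 4] missing vertices, and
   [2 * (v - sumn ls) - 2 <= 2 * (v - 4)] because [sumn ls >= 3]. *)
have good n H G : 2 * v <= n + 4 -> G \in Gs -> halving ls G H ->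
  [/\ forall z, deg H z <= 2, \sum_z (2 - deg H z) <= 2 * (n - v) & perm_eq (cs H) ls].
  move=> wv GG hH; have [tG _] := hG G GG; have /andP[/andP[HG c1] _] := hH.
  split=> // [z|].
    by have /two_regularP[_ dG] := tG; rewrite -(dG z) deg_subset.
  by move: (halving_free x0 vE tG hH); clear -wv L3; lia.
split=> [|[i [j [/andP[/andP[hi hj] ij] [h [N [hh [hN NG] c1 c2 /andP[/andP[shN dhN] _]]]]]]]].
  have [s1 s2 s3] := halvesP x0 hG.
  apply: (@OP_solvable_embed v _ ls (halves ls Gs) M) => //.
  - by apply: leq_trans w1 _; exact: leq_subr.
  - by rewrite s1.
  - by move=> e; rewrite s2.
  - move=> H /s3[G GG hH]; apply: good GG hH; apply: leq_trans w4 _.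
    by rewrite leq_add2r leq_subr.
set G1 := nth set0 Gs i in NG c1; set G2 := nth set0 Gs j in hh.
have [r pr] := perm_nth2 set0 hi hj ij; rewrite -/G1 -/G2 in pr.
have sr G : G \in r -> G \in Gs by move=> Gr; rewrite (perm_mem pr) !in_cons Gr !orbT.
have [s1 s2 s3] := halvesP x0 (fun G Gr => hG G (sr G Gr)).
have sz := perm_size pr; rewrite /= in sz.
have [tG1 _] := hG G1 (mem_nth _ hi).
have /two_regularP[sG1 dG1] := tG1.
have /andP[/andP[hG2 ch] ch'] := hh.
(* Moving the matching [N] from [G1] to [h] turns [G1] and [G2] into three graphs with cycles [ls],
   where halving would give four. *)
apply: (@OP_solvable_embed v _ ls [:: G1 :\: N, h :|: N, G2 :\: h & halves ls r] M) => //.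
- by rewrite target_order2.
- by rewrite target_order2 // -/w w2 sz /= s1; clear; lia.
- by rewrite target_order2 // -/w -w3; clear -w1; lia.
- move=> e; rewrite -hp (permP pr) /= s2; congr (_ + _).
  have := count_split e NG; have := count_split e hG2; rewrite in_setU.
  (* [G1] and [G2] are edge-disjoint, so [N] and [h] do not overlap and the three graphs partition
     the edges of both. *)
  have : (e \in G1) + (e \in G2) <= 1.
    by have := hp e; rewrite (permP pr) /=; case: (e \in Kv v); clear; lia.
  rewrite !in_setD; move: (e \in h) (e \in N) (e \in G1) (e \in G2) (count _ _).
  by clear; do 4!case=> //=; lia.
- have wv : 2 * v <= 2 * x + 3 * sumn ls - (~~ odd v + 1) - 2 + sumn ls + 4.
    by rewrite target_order2.
  move=> H; rewrite !in_cons => /or4P[/eqP->|/eqP->|/eqP->|/s3[G Gr]].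
  (* Removing a matching leaves degree at least one, so at most [v] half-edges are free; [v >= 9]
     gives [v <= 2 * (v - 4)]. *)
  + have d z : deg (G1 :\: N) z <= 2 by rewrite -(dG1 z) deg_subset ?subsetDl.
    split=> //; apply: (@leq_trans (\sum_(z < v) 1)); last first.
      by rewrite sum1_card card_ord; clear -wv vE x3 L3; lia.
    apply: leq_sum => z _; have := deg_setD z NG; rewrite dG1.
    by have /andP[_ /forallP/(_ z)] := hN; clear; lia.
  (* Adding [N] to the half [h] can only lower its number of free half-edges. *)
  + have [_ b _] := good _ h G2 wv (mem_nth _ hj) hh.
    split=> //; first exact/forallP.
    apply: leq_trans b; apply: leq_sum => z _; apply: leq_sub2l.
    by rewrite deg_subset ?subsetUl.
  + exact: good wv (mem_nth _ hj) (halving_compl hh).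
  + by apply: good wv (sr _ Gr).
Qed.
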